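(* Let $a>0$, $m_1>0$, $m_2,f\in\mathbb{R}$. On the region $\mathcal{R}\subset T\mathbb{R}^2$ let $\tilde E_{Eucl,a}=E_{Kep}+\langle\tilde V_{Eucl,2}\rangle$ be the Hamiltonian of the partially-averaged Lagrange problem, obtained by averaging $\tilde V_{Eucl,2}$ (the sum of the potential of the second Kepler center and of a Hooke potential centered at the midpoint of the two Kepler centers) along the closed orbits of $E_{Kep}$, and let $D$ be the function defined in the context. Then $D$ is a first integral of the partially-averaged system: $$\{\tilde E_{Eucl,a},D\}=0\quad\text{on }\mathcal{R}.$$
   Context: Setting: $\mathbb{R}^2$ with coordinates $(x,y)$ and norm $\|(u,v)\|_a=\sqrt{u^2+\frac{v^2}{1+a^2}}$. Kepler centers of masses $m_1,m_2$ are at $(0,a)$ and $(0,-a)$, and a Hooke center with factor $f$ is at $(0,0)$. The energy of the Lagrange problem is $$\tilde E_{Eucl}=\tfrac12\Big(\dot x^2+\tfrac{\dot y^2}{1+a^2}\Big)-\frac{m_1}{\sqrt{x^2+\frac{(y-a)^2}{1+a^2}}}-\frac{m_2}{\sqrt{x^2+\frac{(y+a)^2}{1+a^2}}}+f\Big(x^2+\frac{y^2}{1+a^2}\Big)=E_{Kep}+\tilde V_{Eucl,2},$$ where $E_{Kep}=\tfrac12\big(\dot x^2+\tfrac{\dot y^2}{1+a^2}\big)-\frac{m_1}{\sqrt{x^2+(y-a)^2/(1+a^2)}}$ and $\tilde V_{Eucl,2}=-\frac{m_2}{\sqrt{x^2+(y+a)^2/(1+a^2)}}+f\big(x^2+\frac{y^2}{1+a^2}\big)$.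 The tangent bundle $T\mathbb{R}^2$ carries the Poisson bracket transported from $T^*\mathbb{R}^2$ via the Legendre transformation of the kinetic energy $\frac12\|(\dot x,\dot y)\|_a^2$. In the coordinates $\xi=x$, $\eta=(y-a)/\sqrt{1+a^2}$ the norm is the standard Euclidean one, the first center is at the origin, and the bracket is the standard one in $(\xi,\eta,\dot\xi,\dot\eta)$. Region: $\mathcal{R}$ is the set of points of $T\mathbb{R}^2$ with $E_{Kep}<0$, nonzero Kepler angular momentum $C=\xi\dot\eta-\eta\dot\xi\neq0$, and whose orbit under $E_{Kep}$ does not project to a curve passing through the second Kepler center $(0,-a)$. All orbits of $E_{Kep}$ in $\mathcal{R}$ are closed. Average: $\langle\tilde V_{Eucl,2}\rangle(z)=\int_{S^1}\tilde V_{Eucl,2}\,ds=\frac1T\int_0^T\tilde V_{Eucl,2}(\varphi_t(z))\,dt$, where $\varphi_t$ is the flow of $E_{Kep}$ and $T=T(z)$ the period of the orbit of $z$. The function $D$: $D=(\xi\dot\eta-\eta\dot\xi)^2-\frac{2a}{\sqrt{1+a^2}}\Big((\xi\dot\eta-\eta\dot\xi)\dot\xi+\frac{m_1\eta}{\sqrt{\xi^2+\eta^2}}\Big)$. *)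

(* Defs.v *)
From Stdlib Require Import Reals ClassicalEpsilon.
From Coquelicot Require Import Coquelicot.
Open Scope R_scope.

Record TR2 := mkTR2 { pos_x : R; pos_y : R; vel_x : R; vel_y : R }.

Definition norm_a (a u v : R) : R := sqrt (u ^ 2 + v ^ 2 / (1 + a ^ 2)).

Definition xi (z : TR2) : R := pos_x z.
Definition eta (a : R) (z : TR2) : R := (pos_y z - a) / sqrt (1 + a ^ 2).
Definition xi_dot (z : TR2) : R := vel_x z.
Definition eta_dot (a : R) (z : TR2) : R := vel_y z / sqrt (1 + a ^ 2).

Definition angular_momentum (a : R) (z : TR2) : R :=
  xi z * eta_dot a z - eta a z * xi_dot z.

Definition E_Kep (a m1 : R) (z : TR2) : R :=
  / 2 * (vel_x z ^ 2 + vel_y z ^ 2 / (1 + a ^ 2))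
  - m1 / norm_a a (pos_x z) (pos_y z - a).

Definition V_Eucl_2 (a m2 f : R) (z : TR2) : R :=
  - (m2 / norm_a a (pos_x z) (pos_y z + a))
  + f * (pos_x z ^ 2 + pos_y z ^ 2 / (1 + a ^ 2)).

Definition D_integral (a m1 : R) (z : TR2) : R :=
  angular_momentum a z ^ 2
  - 2 * a / sqrt (1 + a ^ 2)
    * (angular_momentum a z * xi_dot z
       + m1 * eta a z / sqrt (xi z ^ 2 + eta a z ^ 2)).

(* The Legendre transformation of the kinetic energy (1/2) |(vx, vy)|_a^2 is
   (x, y, vx, vy) |-> (x, y, px, py) = (x, y, vx, vy / (1 + a^2)).
   [on_cotangent a F] is the function F on TR^2, read on T*R^2 through the
   inverse of this map. *)
Definition legendre_px (z : TR2) : R := vel_x z.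
Definition legendre_py (a : R) (z : TR2) : R := vel_y z / (1 + a ^ 2).
Definition on_cotangent (a : R) (F : TR2 -> R) (x y px py : R) : R :=
  F (mkTR2 x y px ((1 + a ^ 2) * py)).

Definition d_x (a : R) (F : TR2 -> R) (z : TR2) : R :=
  Derive (fun s => on_cotangent a F s (pos_y z) (legendre_px z) (legendre_py a z))
    (pos_x z).
Definition d_y (a : R) (F : TR2 -> R) (z : TR2) : R :=
  Derive (fun s => on_cotangent a F (pos_x z) s (legendre_px z) (legendre_py a z))
    (pos_y z).
Definition d_px (a : R) (F : TR2 -> R) (z : TR2) : R :=
  Derive (fun s => on_cotangent a F (pos_x z) (pos_y z) s (legendre_py a z))
    (legendre_px z).
Definition d_py (a : R) (F : TR2 -> R) (z : TR2) : R :=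
  Derive (fun s => on_cotangent a F (pos_x z) (pos_y z) (legendre_px z) s)
    (legendre_py a z).

Definition ex_partials (a : R) (F : TR2 -> R) (z : TR2) : Prop :=
  ex_derive (fun s => on_cotangent a F s (pos_y z) (legendre_px z) (legendre_py a z))
    (pos_x z) /\
  ex_derive (fun s => on_cotangent a F (pos_x z) s (legendre_px z) (legendre_py a z))
    (pos_y z) /\
  ex_derive (fun s => on_cotangent a F (pos_x z) (pos_y z) s (legendre_py a z))
    (legendre_px z) /\
  ex_derive (fun s => on_cotangent a F (pos_x z) (pos_y z) (legendre_px z) s)
    (legendre_py a z).

(* [Derive] is total, so the value of [poisson_bracket] is only meaningful
   together with [ex_partials] for both arguments. *)
Definition poisson_bracket (a : R) (F G : TR2 -> R) (z : TR2) : R :=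
  (d_x a F z * d_px a G z - d_px a F z * d_x a G z)
  + (d_y a F z * d_py a G z - d_py a F z * d_y a G z).

Definition is_integral_curve (a : R) (H : TR2 -> R) (g : R -> TR2) : Prop :=
  forall t : R,
    is_derive (fun s => pos_x (g s)) t (poisson_bracket a pos_x H (g t)) /\
    is_derive (fun s => pos_y (g s)) t (poisson_bracket a pos_y H (g t)) /\
    is_derive (fun s => vel_x (g s)) t (poisson_bracket a vel_x H (g t)) /\
    is_derive (fun s => vel_y (g s)) t (poisson_bracket a vel_y H (g t)).

(* Division by zero being total, E_Kep also has a value at the first center
   (0, a): collision-free motion has to be required explicitly. *)
Definition is_kepler_motion (a m1 : R) (z : TR2) (g : R -> TR2) : Prop :=
  g 0 = z /\
  is_integral_curve a (E_Kep a m1) g /\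
  (forall t : R, (pos_x (g t), pos_y (g t)) <> (0, a)).

(* Unspecified at points z without a complete collision-free motion; for
   m1 > 0, every z of nonzero angular momentum has exactly one such motion. *)
Definition kepler_flow (a m1 t : R) (z : TR2) : TR2 :=
  epsilon (inhabits (fun _ : R => z)) (is_kepler_motion a m1 z) t.

Definition is_minimal_period (a m1 : R) (z : TR2) (T : R) : Prop :=
  0 < T /\
  kepler_flow a m1 T z = z /\
  (forall t : R, 0 < t < T -> kepler_flow a m1 t z <> z).

Definition kepler_period (a m1 : R) (z : TR2) : R :=
  epsilon (inhabits 0) (is_minimal_period a m1 z).

Definition average (a m1 : R) (V : TR2 -> R) (z : TR2) : R :=
  / kepler_period a m1 z
  * RInt (fun t => V (kepler_flow a m1 t z)) 0 (kepler_period a m1 z).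

Definition region (a m1 : R) (z : TR2) : Prop :=
  E_Kep a m1 z < 0 /\
  angular_momentum a z <> 0 /\
  (forall t : R,
     (pos_x (kepler_flow a m1 t z), pos_y (kepler_flow a m1 t z)) <> (0, - a)).

Definition E_Eucl_a (a m1 m2 f : R) (z : TR2) : R :=
  E_Kep a m1 z + average a m1 (V_Eucl_2 a m2 f) z.

(* Main.v *)
Require Import Defs.
From Stdlib Require Import Reals Lra ClassicalEpsilon.
From Coquelicot Require Import Coquelicot.
Open Scope R_scope.

(* In the coordinates (xi, eta) the bound Kepler orbits are parametrised by the eccentric
   anomaly s as q(s) = c + A cos s + B sin s, r(s) = r_0 + r_1 cos s + r_2 sin s with
   dt = r ds / k, k = sqrt (-2 E), so that the average becomes an integral over a fixed
   interval, <V> = k^2 / (2 pi m) * int_0^(2 pi) V(q(s)) r(s) ds, in which c, A, B, r_0, r_1, r_2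
   are explicit functions of the initial state; it can be differentiated under the integral
   sign.  The bracket with D is the derivative along the Hamiltonian vector field of D.  Since
   {E_Kep, D} = 0, the displacement of the orbit along that field is, up to a shift of the
   anomaly, the same vector field at q(s).  The unaveraged problem is separable, i.e. there is a
   function W of the position with {V, D} = dW/dt along Kepler motions; hence the integrand of
   {<V>, D} is the s-derivative of a 2 pi-periodic function and integrates to zero. *)

(** * Orbital elements *)

(** [kepler_flow] and [kepler_period] are chosen by [epsilon], so nothing is known about the average
    before existence and uniqueness of the motion and of its minimal period are proved. No general
    theorem on differential equations is invoked: conservation of energy and of the Runge-Lenz
    vector makes the regularised equations linear, so every motion is an explicit ellipse, and
    Kepler's equation, a bijection of the real line, fixes its parametrisation. With e = a / sqrt (1
    + a^2) the second center lies at (0, -2 e) and the Hooke center at (0, -e) in the coordinates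
    (xi, eta). There D = C^2 + 2 e A_y, where C is the angular momentum and A the Runge-Lenz vector
    about the first center; D is thus a function of Kepler integrals, which is the reason for
    {E_Kep, D} = 0. *)

Record phase := Phase { qx : R; qy : R; px : R; py : R }.

Definition radius (z : phase) : R := sqrt (qx z ^ 2 + qy z ^ 2).
Definition ang (z : phase) : R := qx z * py z - qy z * px z.
(* Twice the binding energy: [- 2 E_Kep]. *)
Definition bind (m : R) (z : phase) : R := 2 * m / radius z - (px z ^ 2 + py z ^ 2).
Definition lrl_x (m : R) (z : phase) : R := ang z * py z - m * qx z / radius z.
Definition lrl_y (m : R) (z : phase) : R := - (ang z * px z) - m * qy z / radius z.

Definition freq (m : R) (z : phase) : R := sqrt (bind m z).
(* The orbit is q(s) = center + (cos_x, cos_y) cos s + (sin_x, sin_y) sin s, with distance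
   rad_0 + rad_cos cos s + rad_sin sin s to the first center, s being the eccentric anomaly
   counted from the initial state. *)
Definition center_x (m : R) (z : phase) : R := - lrl_x m z / bind m z.
Definition center_y (m : R) (z : phase) : R := - lrl_y m z / bind m z.
Definition cos_x (m : R) (z : phase) : R := qx z - center_x m z.
Definition cos_y (m : R) (z : phase) : R := qy z - center_y m z.
Definition sin_x (m : R) (z : phase) : R := radius z * px z / freq m z.
Definition sin_y (m : R) (z : phase) : R := radius z * py z / freq m z.
Definition rad_0 (m : R) (z : phase) : R := m / bind m z.
Definition rad_cos (m : R) (z : phase) : R := radius z - rad_0 m z.
Definition rad_sin (m : R) (z : phase) : R := (qx z * px z + qy z * py z) / freq m z.

(** This is the complex square root x + i y = (p + i s)^2 with nonnegative real part; the sign of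
    [y] is carried by [s]. *)
Lemma levi_civita (x y : R) :
  exists p s, x = p ^ 2 - s ^ 2 /\ y = 2 * p * s /\ sqrt (x ^ 2 + y ^ 2) = p ^ 2 + s ^ 2.
Proof.
set (r := sqrt (x ^ 2 + y ^ 2)).
assert (hr : r ^ 2 = x ^ 2 + y ^ 2) by (apply pow2_sqrt; nra).
assert (hr0 : 0 <= r) by apply sqrt_pos.
assert (h1 : 0 <= (r + x) / 2) by nra.
assert (h2 : 0 <= (r - x) / 2) by nra.
assert (hp := pow2_sqrt _ h1); assert (hs := pow2_sqrt _ h2).
assert (hps : sqrt ((r + x) / 2) * sqrt ((r - x) / 2) = Rabs y / 2).
{ rewrite <- sqrt_mult by assumption.
  replace ((r + x) / 2 * ((r - x) / 2)) with ((Rabs y / 2) ^ 2).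
  - apply sqrt_pow2. generalize (Rabs_pos y); lra.
  - unfold Rdiv at 1. rewrite Rpow_mult_distr, pow2_abs. nra. }
destruct (Rle_dec 0 y) as [hy | hy].
- exists (sqrt ((r + x) / 2)), (sqrt ((r - x) / 2)).
  rewrite Rabs_right in hps by lra. repeat split; lra.
- exists (sqrt ((r + x) / 2)), (- sqrt ((r - x) / 2)).
  rewrite Rabs_left in hps by lra. repeat split; nra.
Qed.

(* The Levi-Civita coordinates and [k = sqrt (-2 E)] turn every identity between the
   orbital elements into an identity of rational functions in free variables. *)
Lemma rational_form (m : R) (z : phase) (hr : 0 < radius z) (hb : 0 < bind m z) :
  exists p s k, p ^ 2 + s ^ 2 <> 0 /\ k <> 0 /\ 0 < k /\
    qx z = p ^ 2 - s ^ 2 /\ qy z = 2 * p * s /\ radius z = p ^ 2 + s ^ 2 /\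
    m = (p ^ 2 + s ^ 2) * (k ^ 2 + px z ^ 2 + py z ^ 2) / 2 /\
    bind m z = k ^ 2 /\ freq m z = k.
Proof.
destruct (levi_civita (qx z) (qy z)) as (p & s & hx & hy & hps).
change (radius z = p ^ 2 + s ^ 2) in hps.
exists p, s, (freq m z).
assert (hk : 0 < freq m z) by (apply sqrt_lt_R0; exact hb).
assert (hk2 : freq m z ^ 2 = bind m z) by (apply pow2_sqrt; lra).
repeat split; try lra.
rewrite hk2, <- hps. unfold bind. field. lra.
Qed.

Ltac rationalize :=
  match goal with
  | hr : 0 < radius ?z, hb : 0 < bind ?m ?z |- _ =>
    let p := fresh "p" in let s := fresh "s" in let k := fresh "k" in
    let hps := fresh "hps" in let hk := fresh "hk" in let hk0 := fresh "hk0" in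
    let hx := fresh "hx" in let hy := fresh "hy" in let hrad := fresh "hrad" in
    let hm := fresh "hm" in let hbd := fresh "hbd" in let hfr := fresh "hfr" in
    destruct (rational_form m z hr hb)
      as (p & s & k & hps & hk & hk0 & hx & hy & hrad & hm & hbd & hfr);
    unfold cos_x, cos_y, sin_x, sin_y, rad_cos, rad_sin, rad_0, center_x, center_y,
      lrl_x, lrl_y, ang;
    rewrite ?hbd, ?hfr, ?hrad, ?hx, ?hy;
    (* [m] goes last: [bind m z] and [freq m z] must be recognised before [m] itself is replaced. *)
    rewrite ?hm
  end.

(** [ang z ^ 2 / bind m z] is the square of the semi-minor axis. This lemma and the next five are
    the comparison of coefficients in |q(s)|^2 = r(s)^2, used in [orb_sq]. *)
Lemma cos_axis_sq (m : R) (z : phase) (hr : 0 < radius z) (hb : 0 < bind m z) :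
  cos_x m z ^ 2 + cos_y m z ^ 2 = rad_cos m z ^ 2 + ang z ^ 2 / bind m z.
Proof. rationalize. field. auto. Qed.

Lemma sin_axis_sq (m : R) (z : phase) (hr : 0 < radius z) (hb : 0 < bind m z) :
  sin_x m z ^ 2 + sin_y m z ^ 2 = rad_sin m z ^ 2 + ang z ^ 2 / bind m z.
Proof. rationalize. field. auto. Qed.

Lemma cos_sin_axes_dot (m : R) (z : phase) (hr : 0 < radius z) (hb : 0 < bind m z) :
  cos_x m z * sin_x m z + cos_y m z * sin_y m z = rad_cos m z * rad_sin m z.
Proof. rationalize. field. auto. Qed.

Lemma center_dot_cos_axis (m : R) (z : phase) (hr : 0 < radius z) (hb : 0 < bind m z) :
  center_x m z * cos_x m z + center_y m z * cos_y m z = rad_0 m z * rad_cos m z.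
Proof. rationalize. field. auto. Qed.

Lemma center_dot_sin_axis (m : R) (z : phase) (hr : 0 < radius z) (hb : 0 < bind m z) :
  center_x m z * sin_x m z + center_y m z * sin_y m z = rad_0 m z * rad_sin m z.
Proof. rationalize. field. auto. Qed.

Lemma center_sq (m : R) (z : phase) (hr : 0 < radius z) (hb : 0 < bind m z) :
  center_x m z ^ 2 + center_y m z ^ 2 = rad_0 m z ^ 2 - ang z ^ 2 / bind m z.
Proof. rationalize. field. auto. Qed.

(** [rad_0] is the semi-major axis and the left side the squared distance from focus to center. For
    nonzero angular momentum it is strictly below [rad_0 ^ 2], which keeps the orbit away from the
    first center. *)
Lemma eccentricity (m : R) (z : phase) (hr : 0 < radius z) (hb : 0 < bind m z) :
  rad_cos m z ^ 2 + rad_sin m z ^ 2 = rad_0 m z ^ 2 - ang z ^ 2 / bind m z.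
Proof. rationalize. field. auto. Qed.

(** This is the coefficient of cos^2 + sin^2 in Newton's equation for the orbit, see
    [orb_x_accel]. *)
Lemma center_x_combination (m : R) (z : phase) (hr : 0 < radius z) (hb : 0 < bind m z) :
  rad_cos m z * cos_x m z + rad_sin m z * sin_x m z = rad_0 m z * center_x m z.
Proof. rationalize. field. auto. Qed.

Lemma center_y_combination (m : R) (z : phase) (hr : 0 < radius z) (hb : 0 < bind m z) :
  rad_cos m z * cos_y m z + rad_sin m z * sin_y m z = rad_0 m z * center_y m z.
Proof. rationalize. field. auto. Qed.

(** This and the next two lemmas give the Fourier coefficients of the cross product of q and q',
    needed in [orb_ang]. *)
Lemma cos_sin_axes_cross (m : R) (z : phase) (hr : 0 < radius z) (hb : 0 < bind m z) :
  cos_x m z * sin_y m z - cos_y m z * sin_x m z = rad_0 m z * ang z / freq m z.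
Proof. rationalize. field. auto. Qed.
Lemma cos_axis_cross_center (m : R) (z : phase) (hr : 0 < radius z) (hb : 0 < bind m z) :
  cos_x m z * center_y m z - cos_y m z * center_x m z = rad_sin m z * ang z / freq m z.
Proof. rationalize. field. auto. Qed.
Lemma center_cross_sin_axis (m : R) (z : phase) (hr : 0 < radius z) (hb : 0 < bind m z) :
  center_x m z * sin_y m z - center_y m z * sin_x m z = rad_cos m z * ang z / freq m z.
Proof. rationalize. field. auto. Qed.

(** * Orbits in the eccentric anomaly *)

Definition harm (c p q s : R) : R := c + p * cos s + q * sin s.
Definition orb_x (m : R) (z : phase) (s : R) : R := harm (center_x m z) (cos_x m z) (sin_x m z) s.
Definition orb_y (m : R) (z : phase) (s : R) : R := harm (center_y m z) (cos_y m z) (sin_y m z) s.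
Definition orb_r (m : R) (z : phase) (s : R) : R := harm (rad_0 m z) (rad_cos m z) (rad_sin m z) s.
Definition orb_x' (m : R) (z : phase) (s : R) : R := harm 0 (sin_x m z) (- cos_x m z) s.
Definition orb_y' (m : R) (z : phase) (s : R) : R := harm 0 (sin_y m z) (- cos_y m z) s.
Definition orb_r' (m : R) (z : phase) (s : R) : R := harm 0 (rad_sin m z) (- rad_cos m z) s.
(** Kepler's equation, with the anomaly counted from the initial state: the time at which anomaly
    [s] is reached, that is, the primitive of r / k vanishing at 0. *)
Definition orb_t (m : R) (z : phase) (s : R) : R :=
  (rad_0 m z * s + rad_cos m z * sin s + rad_sin m z * (1 - cos s)) / freq m z.
Definition orbit (m : R) (z : phase) (s : R) : phase :=
  Phase (orb_x m z s) (orb_y m z s)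
    (freq m z * orb_x' m z s / orb_r m z s) (freq m z * orb_y' m z s / orb_r m z s).

Lemma cos_sin_sq (s : R) : cos s ^ 2 + sin s ^ 2 = 1.
Proof. generalize (sin2_cos2 s); unfold Rsqr; nra. Qed.

Lemma is_derive_harm (c p q s : R) : is_derive (harm c p q) s (harm 0 q (- p) s).
Proof. unfold harm. auto_derive; [exact I | ring]. Qed.

Lemma freq_pos (m : R) (z : phase) : 0 < bind m z -> 0 < freq m z.
Proof. apply sqrt_lt_R0. Qed.

Lemma freq_sq (m : R) (z : phase) : 0 < bind m z -> freq m z ^ 2 = bind m z.
Proof. intros h; apply pow2_sqrt; lra. Qed.

Lemma orb_sq (m : R) (z : phase) (s : R) (hr : 0 < radius z) (hb : 0 < bind m z) :
  orb_x m z s ^ 2 + orb_y m z s ^ 2 = orb_r m z s ^ 2.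
Proof.
generalize (cos_axis_sq m z hr hb) (sin_axis_sq m z hr hb) (cos_sin_axes_dot m z hr hb)
  (center_dot_cos_axis m z hr hb) (center_dot_sin_axis m z hr hb) (center_sq m z hr hb)
  (cos_sin_sq s).
unfold orb_x, orb_y, orb_r, harm.
generalize (ang z ^ 2 / bind m z); intros b2 h1 h2 h3 h4 h5 h6 h.
apply Rminus_diag_uniq.
(* Sorted by monomials in cos and sin, each bracket is known; what remains is [b2] times cos^2 +
   sin^2 - 1. *)
transitivity ((center_x m z ^ 2 + center_y m z ^ 2 - rad_0 m z ^ 2)
  + 2 * cos s * (center_x m z * cos_x m z + center_y m z * cos_y m z - rad_0 m z * rad_cos m z)
  + 2 * sin s * (center_x m z * sin_x m z + center_y m z * sin_y m z - rad_0 m z * rad_sin m z)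
  + cos s ^ 2 * (cos_x m z ^ 2 + cos_y m z ^ 2 - rad_cos m z ^ 2)
  + sin s ^ 2 * (sin_x m z ^ 2 + sin_y m z ^ 2 - rad_sin m z ^ 2)
  + 2 * sin s * cos s * (cos_x m z * sin_x m z + cos_y m z * sin_y m z
       - rad_cos m z * rad_sin m z));
  [ring|].
rewrite h1, h2, h3, h4, h5, h6.
transitivity (b2 * (cos s ^ 2 + sin s ^ 2 - 1)); [ring | rewrite h; ring].
Qed.

Lemma harm_ge (c p q s : R) : c - sqrt (p ^ 2 + q ^ 2) <= harm c p q s.
Proof.
unfold harm.
assert (h : Rabs (p * cos s + q * sin s) <= sqrt (p ^ 2 + q ^ 2)).
{ rewrite <- (sqrt_pow2 (Rabs (p * cos s + q * sin s))) by apply Rabs_pos.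
  apply sqrt_le_1_alt. rewrite pow2_abs.
  (* (p cos s + q sin s)^2 + (p sin s - q cos s)^2 = p^2 + q^2. *)
  generalize (cos_sin_sq s) (pow2_ge_0 (p * sin s - q * cos s)); nra. }
apply Rabs_le_between in h. lra.
Qed.

(** The bound is the pericenter distance. Its uniformity in [s] is what makes [orb_t] a bijection of
    the whole line. *)
Lemma orb_r_lower (m : R) (z : phase) (hm : 0 < m) (hr : 0 < radius z)
  (hb : 0 < bind m z) (hc : ang z <> 0) :
  exists mu, 0 < mu /\ forall s, mu <= orb_r m z s.
Proof.
exists (rad_0 m z - sqrt (rad_cos m z ^ 2 + rad_sin m z ^ 2)); split.
- assert (hal : 0 < rad_0 m z) by (apply Rdiv_lt_0_compat; assumption).
  assert (hc2 : 0 < ang z ^ 2 / bind m z)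
    by (apply Rdiv_lt_0_compat; [apply pow2_gt_0|]; assumption).
  enough (sqrt (rad_cos m z ^ 2 + rad_sin m z ^ 2) < rad_0 m z) by lra.
  rewrite <- (sqrt_pow2 (rad_0 m z)) by lra.
  apply sqrt_lt_1_alt. rewrite eccentricity by assumption.
  split; [|lra].
  rewrite <- eccentricity by assumption.
  generalize (pow2_ge_0 (rad_cos m z)) (pow2_ge_0 (rad_sin m z)); lra.
- intros s; apply harm_ge.
Qed.

Lemma orb_r_pos (m : R) (z : phase) (s : R) (hm : 0 < m) (hr : 0 < radius z)
  (hb : 0 < bind m z) (hc : ang z <> 0) : 0 < orb_r m z s.
Proof.
destruct (orb_r_lower m z hm hr hb hc) as (mu & h1 & h2).
generalize (h2 s); lra.
Qed.

Lemma radius_orbit (m : R) (z : phase) (s : R) (hm : 0 < m) (hr : 0 < radius z)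
  (hb : 0 < bind m z) (hc : ang z <> 0) : radius (orbit m z s) = orb_r m z s.
Proof.
unfold radius; cbn [qx qy orbit].
rewrite orb_sq by assumption.
apply sqrt_pow2. apply Rlt_le, orb_r_pos; assumption.
Qed.

(* As q'' = - (q - c), this is Newton's equation q'' r - q' r' = - rad_0 q. *)
Lemma orb_x_accel (m : R) (z : phase) (s : R) (hr : 0 < radius z) (hb : 0 < bind m z) :
  (orb_x m z s - center_x m z) * orb_r m z s + orb_x' m z s * orb_r' m z s
  = rad_0 m z * orb_x m z s.
Proof.
generalize (center_x_combination m z hr hb) (cos_sin_sq s).
unfold orb_x, orb_x', orb_r, orb_r', harm; intros h1 h2.
transitivity (rad_0 m z * (cos_x m z * cos s + sin_x m z * sin s)
  + (rad_cos m z * cos_x m z + rad_sin m z * sin_x m z) * (cos s ^ 2 + sin s ^ 2)); [ring|].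
rewrite h1, h2; ring.
Qed.

Lemma orb_y_accel (m : R) (z : phase) (s : R) (hr : 0 < radius z) (hb : 0 < bind m z) :
  (orb_y m z s - center_y m z) * orb_r m z s + orb_y' m z s * orb_r' m z s
  = rad_0 m z * orb_y m z s.
Proof.
generalize (center_y_combination m z hr hb) (cos_sin_sq s).
unfold orb_y, orb_y', orb_r, orb_r', harm; intros h1 h2.
transitivity (rad_0 m z * (cos_y m z * cos s + sin_y m z * sin s)
  + (rad_cos m z * cos_y m z + rad_sin m z * sin_y m z) * (cos s ^ 2 + sin s ^ 2)); [ring|].
rewrite h1, h2; ring.
Qed.

Lemma is_derive_orb_t (m : R) (z : phase) (s : R) :
  is_derive (orb_t m z) s (orb_r m z s / freq m z).
Proof. unfold orb_t, orb_r, harm. auto_derive; [exact I | unfold Rdiv; ring]. Qed.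

(** A slope of at least [mu] makes [f] expand distances by [mu]. This yields surjectivity through
    intermediate values, injectivity, and a Lipschitz inverse, from which the derivative of the
    inverse is computed directly. *)
Lemma increasing_bijection (f f' : R -> R) (mu : R) (hmu : 0 < mu)
  (hf : forall x, is_derive f x (f' x)) (hf' : forall x, mu <= f' x) :
  exists g, (forall y, f (g y) = y) /\ (forall x, g (f x) = x) /\
    (forall y, is_derive g y (/ f' (g y))).
Proof.
assert (hgrow : forall x y, x <= y -> mu * (y - x) <= f y - f x).
{ intros x y hxy.
  destruct (MVT_gen f x y f') as (c & hc & h).
  - intros; apply hf.
  - intros t _. apply derivable_continuous_pt. exists (f' t). apply is_derive_Reals, hf.
  - rewrite h. apply Rmult_le_compat_r; [lra | apply hf']. }
assert (hlip : forall x y, mu * Rabs (x - y) <= Rabs (f x - f y)).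
{ intros x y. destruct (Rle_dec x y) as [h | h].
  - rewrite (Rabs_minus_sym x), (Rabs_minus_sym (f x)).
    rewrite (Rabs_right (y - x)) by lra.
    eapply Rle_trans; [apply hgrow, h | apply Rle_abs].
  - rewrite (Rabs_right (x - y)) by lra.
    eapply Rle_trans; [apply hgrow; lra | apply Rle_abs]. }
assert (hsurj : forall y, {x | f x = y}).
{ intros y.
  (* [d] is chosen so that growth at rate [mu] puts [y] between f(-d) and f(d). *)
  assert (hd := Rabs_pos (y - f 0)). set (d := Rabs (y - f 0) / mu).
  assert (hd' : mu * d = Rabs (y - f 0)) by (unfold d; field; lra).
  assert (hd0 : 0 <= d) by (apply Rdiv_le_0_compat; assumption).
  assert (h1 := hgrow 0 d hd0). assert (h2 := hgrow (- d) 0 ltac:(lra)).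
  assert (h3 : - Rabs (y - f 0) <= y - f 0 <= Rabs (y - f 0))
    by (apply Rabs_le_between; lra).
  destruct (IVT_gen f (- d) d y) as (x & _ & hx).
  - intros t. apply derivable_continuous_pt. exists (f' t). apply is_derive_Reals, hf.
  - rewrite Rmin_left, Rmax_right by lra. lra.
  - exists x; exact hx. }
pose (g := fun y => proj1_sig (hsurj y)).
assert (hg : forall y, f (g y) = y) by (intros y; apply proj2_sig).
clearbody g.
assert (hinj : forall x y, f x = f y -> x = y).
{ intros x y h. generalize (hlip x y). rewrite h, Rminus_diag, Rabs_R0.
  intros h'. assert (h0 := Rabs_pos (x - y)).
  apply Rminus_diag_uniq. destruct (Req_dec (x - y) 0) as [e | e]; [exact e|].
  apply Rabs_pos_lt in e. nra. }
exists g; split; [exact hg | split; [intros x; apply hinj, hg|]].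
intros y. apply is_derive_Reals. intros eps heps.
assert (hl := hf' (g y)).
assert (hd := hf (g y)). apply is_derive_Reals in hd.
(* The difference u/t - 1/f' equals -(t/u - f') (u/t) / f', and each of the last two factors costs
   at most 1/mu. *)
destruct (hd (eps * mu * mu)) as (delta & hdelta); [repeat apply Rmult_lt_0_compat; assumption|].
assert (hmd : 0 < mu * delta) by (apply Rmult_lt_0_compat; [exact hmu | apply cond_pos]).
exists (mkposreal _ hmd); simpl. intros t ht0 ht.
set (u := g (y + t) - g y).
assert (hfu : f (g y + u) = y + t).
{ unfold u. replace (g y + (g (y + t) - g y)) with (g (y + t)) by ring. apply hg. }
assert (hut : mu * Rabs u <= Rabs t).
{ generalize (hlip (g y + u) (g y)). rewrite hfu, hg.
  replace (g y + u - g y) with u by ring. now replace (y + t - y) with t by ring. }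
assert (hu0 : u <> 0).
{ intros e. rewrite e, Rplus_0_r, hg in hfu. lra. }
assert (hu : Rabs u < delta).
{ apply Rmult_lt_reg_l with mu; [exact hmu | lra]. }
generalize (hdelta u hu0 hu). rewrite hfu, hg.
replace (y + t - y) with t by ring. intros hq.
replace (u / t - / f' (g y)) with (- (t / u - f' (g y)) * (u / t) * / f' (g y))
  by (field; repeat split; lra).
rewrite !Rabs_mult, Rabs_Ropp.
assert (h1 : Rabs (/ f' (g y)) <= / mu).
{ rewrite Rabs_right by (apply Rle_ge, Rlt_le, Rinv_0_lt_compat; lra).
  apply Rinv_le_contravar; lra. }
assert (h2 : Rabs (u / t) <= / mu).
{ unfold Rdiv. rewrite Rabs_mult, Rabs_inv.
  assert (0 < Rabs t) by now apply Rabs_pos_lt.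
  apply Rmult_le_reg_l with (mu * Rabs t); [apply Rmult_lt_0_compat; assumption|].
  field_simplify; lra. }
assert (h0 : 0 < / mu) by now apply Rinv_0_lt_compat.
apply Rle_lt_trans with (Rabs (t / u - f' (g y)) * (/ mu * / mu)).
- rewrite Rmult_assoc. apply Rmult_le_compat_l; [apply Rabs_pos|].
  apply Rmult_le_compat; auto using Rabs_pos.
- replace eps with (eps * mu * mu * (/ mu * / mu)) by (field; lra).
  apply Rmult_lt_compat_r; [nra | exact hq].
Qed.

Lemma eq_of_derive_0 (f : R -> R) (h : forall t, is_derive f t 0) (t : R) : f t = f 0.
Proof.
destruct (MVT_gen f 0 t (fun _ => 0)) as (c & _ & hc).
- intros; apply h.
- intros s _. apply derivable_continuous_pt. exists 0. apply is_derive_Reals, h.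
- lra.
Qed.

(** * Kepler motions *)

(** The cast accepts any [g] convertible to [f], such as the eta-expansions left by
    [auto_derive]. *)
Ltac rewrite_derivatives :=
  repeat match goal with
  | h : is_derive ?f ?t ?l |- context [Derive ?g ?t] =>
    let e := constr:(is_derive_unique f t l h : Derive g t = l) in rewrite e
  end.

Definition is_motion (m : R) (g : R -> phase) : Prop :=
  forall t, 0 < radius (g t) /\
    is_derive (fun s => qx (g s)) t (px (g t)) /\
    is_derive (fun s => qy (g s)) t (py (g t)) /\
    is_derive (fun s => px (g s)) t (- (m * qx (g t) / radius (g t) ^ 3)) /\
    is_derive (fun s => py (g s)) t (- (m * qy (g t) / radius (g t) ^ 3)).

(** The acceleration of a motion with velocity k q' / r whose anomaly advances at rate k / r, using
    q'' = -(q - c). The center [c] is arbitrary because q' does not depend on it. *)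
Lemma is_derive_quotient_comp (c p q a b d t0 k : R) (th : R -> R)
  (h0 : harm a b d (th t0) <> 0)
  (hth : is_derive th t0 (k / harm a b d (th t0))) :
  is_derive (fun t => k * harm 0 q (- p) (th t) / harm a b d (th t)) t0
    (- (k ^ 2 * ((harm c p q (th t0) - c) * harm a b d (th t0)
         + harm 0 q (- p) (th t0) * harm 0 d (- b) (th t0)) / harm a b d (th t0) ^ 3)).
Proof.
assert (h := is_derive_harm a b d (th t0)).
assert (h' := is_derive_harm 0 q (- p) (th t0)).
auto_derive.
- repeat split; try assumption; try (eexists; eassumption).
- rewrite_derivatives.
  assert (e : harm 0 (- p) (- q) (th t0) = - (harm c p q (th t0) - c))
    by (unfold harm; ring).
  rewrite e. field. exact h0.
Qed.

Lemma orbit_is_motion (m : R) (z : phase) (th : R -> R) (hm : 0 < m) (hr : 0 < radius z)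
  (hb : 0 < bind m z) (hc : ang z <> 0)
  (hth : forall t, is_derive th t (freq m z / orb_r m z (th t))) :
  is_motion m (fun t => orbit m z (th t)).
Proof.
intros t.
assert (hR := orb_r_pos m z (th t) hm hr hb hc).
assert (hk := freq_sq m z hb).
(* Since freq^2 = bind, this turns the factor freq^2 * rad_0 of the acceleration into [m]. *)
assert (hal : rad_0 m z * bind m z = m) by (unfold rad_0; field; lra).
rewrite radius_orbit by assumption.
split; [exact hR|]; simpl.
assert (H : forall c p q, is_derive (fun s => harm c p q (th s)) t
  (freq m z * harm 0 q (- p) (th t) / orb_r m z (th t))).
{ intros c p q.
  replace (freq m z * harm 0 q (- p) (th t) / orb_r m z (th t))
    with (freq m z / orb_r m z (th t) * harm 0 q (- p) (th t)) by (unfold Rdiv; ring).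
  apply (is_derive_comp (harm c p q) th); [apply is_derive_harm | apply hth]. }
split; [apply H|split; [apply H|split]].
- generalize (orb_x_accel m z (th t) hr hb); intros e.
  evar_last.
  + apply (is_derive_quotient_comp (center_x m z)); [apply Rgt_not_eq, hR | apply hth].
  + fold (orb_x m z (th t)) (orb_r m z (th t)) (orb_x' m z (th t)) (orb_r' m z (th t)).
    rewrite hk, e.
    transitivity (- (rad_0 m z * bind m z * orb_x m z (th t) / orb_r m z (th t) ^ 3));
      [field; lra | rewrite hal; reflexivity].
- generalize (orb_y_accel m z (th t) hr hb); intros e.
  evar_last.
  + apply (is_derive_quotient_comp (center_y m z)); [apply Rgt_not_eq, hR | apply hth].
  + fold (orb_y m z (th t)) (orb_r m z (th t)) (orb_y' m z (th t)) (orb_r' m z (th t)).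
    rewrite hk, e.
    transitivity (- (rad_0 m z * bind m z * orb_y m z (th t) / orb_r m z (th t) ^ 3));
      [field; lra | rewrite hal; reflexivity].
Qed.

(** * Uniqueness of motions from the conservation laws *)

Lemma radius_sq (z : phase) : radius z ^ 2 = qx z ^ 2 + qy z ^ 2.
Proof. apply pow2_sqrt. generalize (pow2_ge_0 (qx z)) (pow2_ge_0 (qy z)); lra. Qed.

(** The distance is a function of its own, tied to [X] and [Y] by its square and its derivative, so
    that differentiating conserved quantities gives rational expressions without square roots. *)
Definition kepler_system (m : R) (X Y U W r : R -> R) : Prop :=
  forall t, 0 < r t /\ r t ^ 2 = X t ^ 2 + Y t ^ 2 /\
    is_derive r t ((X t * U t + Y t * W t) / r t) /\
    is_derive X t (U t) /\ is_derive Y t (W t) /\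
    is_derive U t (- (m * X t / r t ^ 3)) /\ is_derive W t (- (m * Y t / r t ^ 3)).

Lemma is_derive_norm (X Y : R -> R) (t x' y' : R) (h : 0 < sqrt (X t ^ 2 + Y t ^ 2))
  (hx : is_derive X t x') (hy : is_derive Y t y') :
  is_derive (fun s => sqrt (X s ^ 2 + Y s ^ 2)) t
    ((X t * x' + Y t * y') / sqrt (X t ^ 2 + Y t ^ 2)).
Proof.
auto_derive.
- repeat split; try (eexists; eassumption).
  apply sqrt_lt_0_alt. rewrite sqrt_0. exact h.
- rewrite_derivatives.
  set (r := sqrt (X t ^ 2 + Y t ^ 2)) in *.
  (* The square root produced by [auto_derive] is only convertible to [r]. *)
  match goal with |- context [/ (2 * ?q)] => change q with r end.
  clearbody r. field. lra.
Qed.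

Lemma motion_system (m : R) (g : R -> phase) (hg : is_motion m g) :
  kepler_system m (fun t => qx (g t)) (fun t => qy (g t)) (fun t => px (g t))
    (fun t => py (g t)) (fun t => radius (g t)).
Proof.
intros t. destruct (hg t) as (h0 & h1 & h2 & h3 & h4).
split; [exact h0 | split; [apply radius_sq | split; [|auto]]].
apply (is_derive_norm (fun t => qx (g t)) (fun t => qy (g t))); assumption.
Qed.

(** Energy and the two Runge-Lenz components: they fix the frequency and the center of the
    oscillator to which the motion reduces. The Runge-Lenz derivatives vanish only modulo r^2 = X^2
    + Y^2. *)
Lemma motion_conserved (m : R) (X Y U W r : R -> R) (hs : kepler_system m X Y U W r) (t : R) :
  2 * m / r t - (U t ^ 2 + W t ^ 2) = 2 * m / r 0 - (U 0 ^ 2 + W 0 ^ 2) /\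
  (X t * W t - Y t * U t) * W t - m * X t / r t
    = (X 0 * W 0 - Y 0 * U 0) * W 0 - m * X 0 / r 0 /\
  - ((X t * W t - Y t * U t) * U t) - m * Y t / r t
    = - ((X 0 * W 0 - Y 0 * U 0) * U 0) - m * Y 0 / r 0.
Proof.
split; [|split].
- apply (eq_of_derive_0 (fun t => 2 * m / r t - (U t ^ 2 + W t ^ 2))). intros s.
  destruct (hs s) as (h0 & hr2 & hr & h1 & h2 & h3 & h4).
  auto_derive.
  + repeat split; try (eexists; eassumption). lra.
  + rewrite_derivatives. field. lra.
- apply (eq_of_derive_0 (fun t => (X t * W t - Y t * U t) * W t - m * X t / r t)). intros s.
  destruct (hs s) as (h0 & hr2 & hr & h1 & h2 & h3 & h4).
  auto_derive.
  + repeat split; try (eexists; eassumption). lra.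
  + rewrite_derivatives.
    transitivity (m * U s * (X s ^ 2 + Y s ^ 2 - r s ^ 2) / r s ^ 3);
      [field; lra | rewrite hr2; field; lra].
- apply (eq_of_derive_0 (fun t => - ((X t * W t - Y t * U t) * U t) - m * Y t / r t)). intros s.
  destruct (hs s) as (h0 & hr2 & hr & h1 & h2 & h3 & h4).
  auto_derive.
  + repeat split; try (eexists; eassumption). lra.
  + rewrite_derivatives.
    transitivity (m * W s * (X s ^ 2 + Y s ^ 2 - r s ^ 2) / r s ^ 3);
      [field; lra | rewrite hr2; field; lra].
Qed.

(** Rotating (y, w) back by the angle [th] gives two constants, which are the initial values. *)
Lemma rotation_solution (y w th om : R -> R) (h0 : th 0 = 0)
  (hth : forall t, is_derive th t (om t))
  (hy : forall t, is_derive y t (om t * w t))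
  (hw : forall t, is_derive w t (- (om t * y t))) (t : R) :
  y t = harm 0 (y 0) (w 0) (th t) /\ w t = harm 0 (w 0) (- y 0) (th t).
Proof.
assert (e1 : y t * cos (th t) - w t * sin (th t) = y 0).
{ transitivity (y 0 * cos (th 0) - w 0 * sin (th 0));
    [|rewrite h0, cos_0, sin_0; ring].
  apply (eq_of_derive_0 (fun t => y t * cos (th t) - w t * sin (th t))). intros s.
  assert (hth' := hth s). assert (hy' := hy s). assert (hw' := hw s).
  auto_derive; [repeat split; eexists; eassumption|].
  rewrite_derivatives. ring. }
assert (e2 : y t * sin (th t) + w t * cos (th t) = w 0).
{ transitivity (y 0 * sin (th 0) + w 0 * cos (th 0));
    [|rewrite h0, cos_0, sin_0; ring].
  apply (eq_of_derive_0 (fun t => y t * sin (th t) + w t * cos (th t))). intros s.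
  assert (hth' := hth s). assert (hy' := hy s). assert (hw' := hw s).
  auto_derive; [repeat split; eexists; eassumption|].
  rewrite_derivatives. ring. }
assert (h := cos_sin_sq (th t)).
unfold harm. rewrite <- e1, <- e2. split.
- transitivity (y t * (cos (th t) ^ 2 + sin (th t) ^ 2)); [rewrite h | ]; ring.
- transitivity (w t * (cos (th t) ^ 2 + sin (th t) ^ 2)); [rewrite h | ]; ring.
Qed.

Lemma antiderivative (f : R -> R) (hf : forall t, continuous f t) :
  exists th, th 0 = 0 /\ forall t, is_derive th t (f t).
Proof.
exists (fun t => RInt f 0 t); split; [exact (RInt_point 0 f)|].
intros t. apply (is_derive_RInt f _ 0); [|apply hf].
apply filter_forall. intros b. apply (@RInt_correct R_CompleteNormedModule).
apply (@ex_RInt_continuous R_CompleteNormedModule). intros; apply hf.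
Qed.

(* With d(theta) = k dt / r the regularised equations (q - c)' = w, w' = - (q - c),
   w = r v / k, turn the motion into a rotation. *)
Lemma system_rotation (m : R) (X Y U W r : R -> R) (z := Phase (X 0) (Y 0) (U 0) (W 0))
  (hs : kepler_system m X Y U W r) (hz : radius z = r 0) (hb : 0 < bind m z) :
  exists th, th 0 = 0 /\ (forall t, is_derive th t (freq m z / r t)) /\
    forall t, X t = orb_x m z (th t) /\ Y t = orb_y m z (th t) /\
      r t * U t / freq m z = orb_x' m z (th t) /\ r t * W t / freq m z = orb_y' m z (th t).
Proof.
assert (hk := freq_pos m z hb). assert (hk2 := freq_sq m z hb).
destruct (antiderivative (fun t => freq m z / r t)) as (th & th0 & hth).
{ intros t. destruct (hs t) as (h0 & _ & hr & _).
  apply (ex_derive_continuous (fun s => freq m z / r s)).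
  auto_derive. repeat split; [eexists; eassumption | lra]. }
exists th; split; [exact th0 | split; [exact hth|]]. intros t.
assert (hcons : forall t, 2 * m / r t - (U t ^ 2 + W t ^ 2) = bind m z /\
  (X t * W t - Y t * U t) * W t - m * X t / r t = lrl_x m z /\
  - ((X t * W t - Y t * U t) * U t) - m * Y t / r t = lrl_y m z).
{ intros s. unfold bind, lrl_x, lrl_y, ang. rewrite hz. now apply motion_conserved. }
destruct (rotation_solution (fun t => X t - center_x m z) (fun t => r t * U t / freq m z)
  th _ th0 hth) with (t := t) as [ex1 ex2].
{ intros s. destruct (hs s) as (h0 & hr2 & hr & h1 & h2 & h3 & h4).
  auto_derive; [eexists; eassumption|].
  rewrite_derivatives. field. split; lra. }
{ intros s. destruct (hs s) as (h0 & hr2 & hr & h1 & h2 & h3 & h4).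
  destruct (hcons s) as (eb & ex & _).
  auto_derive; [repeat split; eexists; eassumption|].
  rewrite_derivatives. unfold center_x. rewrite <- ex.
  (* The middle term is -(X - center) freq / r. Conservation allows freq^2 and the Runge-Lenz
     component, defined at time 0, to be expressed by the state at time [s]. *)
  transitivity (- (freq m z ^ 2 * X s + lrl_x m z) / (r s * freq m z)).
  - rewrite hk2, <- eb, <- ex. field. split; lra.
  - rewrite <- ex, <- hk2. field. split; lra. }
destruct (rotation_solution (fun t => Y t - center_y m z) (fun t => r t * W t / freq m z)
  th _ th0 hth) with (t := t) as [ey1 ey2].
{ intros s. destruct (hs s) as (h0 & hr2 & hr & h1 & h2 & h3 & h4).
  auto_derive; [eexists; eassumption|].
  rewrite_derivatives. field. split; lra. }
{ intros s. destruct (hs s) as (h0 & hr2 & hr & h1 & h2 & h3 & h4).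
  destruct (hcons s) as (eb & _ & ey).
  auto_derive; [repeat split; eexists; eassumption|].
  rewrite_derivatives. unfold center_y. rewrite <- ey.
  transitivity (- (freq m z ^ 2 * Y s + lrl_y m z) / (r s * freq m z)).
  - rewrite hk2, <- eb, <- ey. field. split; lra.
  - rewrite <- ey, <- hk2. field. split; lra. }
unfold orb_x, orb_y, orb_x', orb_y', cos_x, cos_y, sin_x, sin_y; rewrite hz; simpl.
repeat split; [| | exact ex2 | exact ey2].
- cbv beta in ex1. transitivity (center_x m z + (X t - center_x m z)); [ring|].
  rewrite ex1. unfold harm. ring.
- cbv beta in ey1. transitivity (center_y m z + (Y t - center_y m z)); [ring|].
  rewrite ey1. unfold harm. ring.
Qed.

(** Uniqueness: a motion can only run along the explicit orbit, and its anomaly has to satisfy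
    Kepler's equation because [orb_t (th t)] has derivative 1. *)
Lemma motion_is_orbit (m : R) (g : R -> phase) (hm : 0 < m) (hb : 0 < bind m (g 0))
  (hc : ang (g 0) <> 0) (hg : is_motion m g) :
  exists th, (forall t, g t = orbit m (g 0) (th t)) /\
    (forall t, orb_t m (g 0) (th t) = t).
Proof.
assert (hs := motion_system m g hg).
assert (hr : 0 < radius (g 0)) by apply (hg 0).
assert (hz : Phase (qx (g 0)) (qy (g 0)) (px (g 0)) (py (g 0)) = g 0) by now destruct (g 0).
assert (H := system_rotation m _ _ _ _ _ hs). cbv zeta beta in H. rewrite hz in H.
destruct (H eq_refl hb) as (th & th0 & hth & hrot). clear H hs hz.
set (z := g 0) in *.
assert (hk := freq_pos m z hb).
assert (hrad : forall t, radius (g t) = orb_r m z (th t)).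
{ intros t. rewrite <- (radius_orbit m z (th t)) by assumption.
  unfold radius. destruct (hrot t) as (-> & -> & _). reflexivity. }
exists th; split; intros t.
- destruct (hrot t) as (e1 & e2 & e3 & e4).
  assert (h0 : 0 < radius (g t)) by apply (hg t).
  unfold orbit. rewrite <- hrad, <- e1, <- e2, <- e3, <- e4.
  destruct (g t) as [x y u v]. simpl. f_equal; field; split; apply Rgt_not_eq; assumption.
- enough (e : orb_t m z (th t) - t = orb_t m z (th 0) - 0).
  { rewrite th0 in e. unfold orb_t in e at 2. rewrite sin_0, cos_0 in e.
    unfold Rdiv in e. lra. }
  apply (eq_of_derive_0 (fun t => orb_t m z (th t) - t)). intros s.
  replace 0 with (freq m z / radius (g s) * (orb_r m z (th s) / freq m z) - 1).
  + apply (is_derive_minus (fun t => orb_t m z (th t)) (fun t => t)).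
    * apply (is_derive_comp (orb_t m z) th); [apply is_derive_orb_t | apply hth].
    * exact (@is_derive_id R_AbsRing s).
  + rewrite hrad. field. split; apply Rgt_not_eq; [|apply orb_r_pos]; assumption.
Qed.

(** * The coordinates (xi, eta) *)

Definition flat (a : R) (z : TR2) : phase := Phase (xi z) (eta a z) (xi_dot z) (eta_dot a z).
Definition unflat (a : R) (z : phase) : TR2 :=
  mkTR2 (qx z) (a + sqrt (1 + a ^ 2) * qy z) (px z) (sqrt (1 + a ^ 2) * py z).

Lemma one_plus_sq_pos (a : R) : 0 < 1 + a ^ 2.
Proof. generalize (pow2_ge_0 a); lra. Qed.

Lemma scale_pos (a : R) : 0 < sqrt (1 + a ^ 2).
Proof. apply sqrt_lt_R0, one_plus_sq_pos. Qed.

Lemma scale_sq (a : R) : sqrt (1 + a ^ 2) ^ 2 = 1 + a ^ 2.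
Proof. apply pow2_sqrt, Rlt_le, one_plus_sq_pos. Qed.

Lemma flat_unflat (a : R) (z : phase) : flat a (unflat a z) = z.
Proof.
generalize (scale_pos a); intros hs.
destruct z as [x y u v]; unfold flat, unflat, xi, eta, xi_dot, eta_dot;
  cbn [qx qy px py pos_x pos_y vel_x vel_y].

f_equal; field; lra.
Qed.

Lemma unflat_flat (a : R) (z : TR2) : unflat a (flat a z) = z.
Proof.
generalize (scale_pos a); intros hs.
destruct z as [x y u v]; unfold flat, unflat, xi, eta, xi_dot, eta_dot;
  cbn [qx qy px py pos_x pos_y vel_x vel_y].

f_equal; field; lra.
Qed.

Lemma norm_a_flat (a x y : R) : norm_a a x y = sqrt (x ^ 2 + (y / sqrt (1 + a ^ 2)) ^ 2).
Proof.
unfold norm_a, Rdiv. now rewrite Rpow_mult_distr, pow_inv, scale_sq.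
Qed.

Lemma radius_flat (a : R) (z : TR2) : radius (flat a z) = norm_a a (pos_x z) (pos_y z - a).
Proof. rewrite norm_a_flat. reflexivity. Qed.

Lemma radius_flat_pos (a : R) (z : TR2) :
  (pos_x z, pos_y z) <> (0, a) -> 0 < radius (flat a z).
Proof.
intros h. apply sqrt_lt_R0. cbn [qx qy flat]; unfold xi, eta.
generalize (scale_pos a); intros hs.
destruct (Req_dec (pos_x z) 0) as [e | e].
- assert (e' : pos_y z - a <> 0) by (intros e'; apply h; f_equal; lra).
  assert (h' : (pos_y z - a) / sqrt (1 + a ^ 2) <> 0).
  { unfold Rdiv. apply Rmult_integral_contrapositive_currified; [exact e'|].
    apply Rinv_neq_0_compat; lra. }
  apply Rplus_le_lt_0_compat; [apply pow2_ge_0 | apply pow2_gt_0, h'].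
- apply Rplus_lt_le_0_compat; [apply pow2_gt_0, e | apply pow2_ge_0].
Qed.

Lemma radius_flat_ne (a : R) (z : TR2) :
  0 < radius (flat a z) -> (pos_x z, pos_y z) <> (0, a).
Proof.
intros h e. injection e as e1 e2.
revert h; unfold radius, flat; cbn [qx qy]; unfold xi, eta.
rewrite e1, e2. replace (0 ^ 2 + ((a - a) / sqrt (1 + a ^ 2)) ^ 2) with 0.
- rewrite sqrt_0; lra.
- field. generalize (scale_pos a); lra.
Qed.

Lemma bind_flat (a m : R) (z : TR2) : bind m (flat a z) = -2 * E_Kep a m z.
Proof.
unfold bind, E_Kep. rewrite radius_flat. cbn [px py flat]. unfold xi_dot, eta_dot, Rdiv.
rewrite Rpow_mult_distr, pow_inv, scale_sq.
lra.
Qed.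

(** * Hamilton's equations of the Kepler energy *)

Lemma bracket_pos_x (a : R) (H : TR2 -> R) (z : TR2) : poisson_bracket a pos_x H z = d_px a H z.
Proof.
unfold poisson_bracket, d_x at 1, d_px at 2, d_y at 1, d_py at 2, on_cotangent; simpl.
rewrite Derive_id, !Derive_const. ring.
Qed.

Lemma bracket_pos_y (a : R) (H : TR2 -> R) (z : TR2) : poisson_bracket a pos_y H z = d_py a H z.
Proof.
unfold poisson_bracket, d_x at 1, d_px at 2, d_y at 1, d_py at 2, on_cotangent; simpl.
rewrite Derive_id, !Derive_const. ring.
Qed.

Lemma bracket_vel_x (a : R) (H : TR2 -> R) (z : TR2) : poisson_bracket a vel_x H z = - d_x a H z.
Proof.
unfold poisson_bracket, d_x at 1, d_px at 2, d_y at 1, d_py at 2, on_cotangent; simpl.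
rewrite Derive_id, !Derive_const. ring.
Qed.

Lemma bracket_vel_y (a : R) (H : TR2 -> R) (z : TR2) :
  poisson_bracket a vel_y H z = - ((1 + a ^ 2) * d_y a H z).
Proof.
unfold poisson_bracket, d_x at 1, d_px at 2, d_y at 1, d_py at 2, on_cotangent; cbn [vel_y].
rewrite !Derive_const, Derive_scal, Derive_id. ring.
Qed.

Lemma E_Kep_partials (a m : R) (z : TR2) (h : 0 < radius (flat a z)) :
  is_derive (fun s => on_cotangent a (E_Kep a m) s (pos_y z) (legendre_px z) (legendre_py a z))
    (pos_x z) (m * qx (flat a z) / radius (flat a z) ^ 3) /\
  is_derive (fun s => on_cotangent a (E_Kep a m) (pos_x z) s (legendre_px z) (legendre_py a z))
    (pos_y z) (m * qy (flat a z) / radius (flat a z) ^ 3 / sqrt (1 + a ^ 2)) /\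
  is_derive (fun s => on_cotangent a (E_Kep a m) (pos_x z) (pos_y z) s (legendre_py a z))
    (legendre_px z) (vel_x z) /\
  is_derive (fun s => on_cotangent a (E_Kep a m) (pos_x z) (pos_y z) (legendre_px z) s)
    (legendre_py a z) (vel_y z).
Proof.
assert (hp := one_plus_sq_pos a). assert (hs := scale_pos a). assert (hs2 := scale_sq a).
rewrite radius_flat in *.
assert (hn : 0 < pos_x z ^ 2 + (pos_y z - a) ^ 2 / (1 + a ^ 2)).
{ apply sqrt_lt_0_alt. rewrite sqrt_0. exact h. }
unfold on_cotangent, E_Kep; cbn [pos_x pos_y vel_x vel_y].
cbn [qx qy flat]. unfold xi, eta, legendre_px, legendre_py.
unfold norm_a in *.
set (n := sqrt (pos_x z ^ 2 + (pos_y z - a) ^ 2 / (1 + a ^ 2))) in *.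
split; [|split; [|split]].
- auto_derive.
  + split; [exact hn | split; [apply Rgt_not_eq; exact h | exact I]].
  + match goal with |- context [/ (2 * ?q)] => change q with n end.
    clearbody n. field. lra.
- auto_derive.
  + split; [exact hn | split; [apply Rgt_not_eq; exact h | exact I]].
  + match goal with |- context [/ (2 * ?q)] => change q with n end.
    clearbody n. change (a * (a * 1)) with (a ^ 2).
    revert hs hs2. generalize (sqrt (1 + a ^ 2)). intros s hs hs2.
    rewrite <- hs2. field. lra.
- auto_derive; [exact I | field; lra].
- auto_derive; [exact I | field; lra].
Qed.

(** Away from collision [Derive] has its genuine value, so the bracket equations are Newton's. In
    the second coordinate the factor 1 + a^2 of [bracket_vel_y] and the 1 / sqrt (1 + a^2) of the
    gradient leave sqrt (1 + a^2), which the passage to [eta_dot] absorbs. *)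
Lemma integral_curve_flat (a m : R) (g : R -> TR2) :
  (forall t, 0 < radius (flat a (g t))) ->
  is_integral_curve a (E_Kep a m) g <-> is_motion m (fun t => flat a (g t)).
Proof.
intros hr. assert (hs := scale_pos a).
assert (hd : forall t, d_x a (E_Kep a m) (g t) = m * qx (flat a (g t)) / radius (flat a (g t)) ^ 3 /\
  d_y a (E_Kep a m) (g t)
    = m * qy (flat a (g t)) / radius (flat a (g t)) ^ 3 / sqrt (1 + a ^ 2) /\
  d_px a (E_Kep a m) (g t) = vel_x (g t) /\ d_py a (E_Kep a m) (g t) = vel_y (g t)).
{ intros t. destruct (E_Kep_partials a m (g t) (hr t)) as (h1 & h2 & h3 & h4).
  repeat split; apply is_derive_unique; assumption. }
assert (e : forall x, (1 + a ^ 2) * (x / sqrt (1 + a ^ 2)) = sqrt (1 + a ^ 2) * x)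
  by (intros x; rewrite <- (scale_sq a) at 1; field; lra).
split.
- intros h t. split; [apply hr|].
  destruct (h t) as (h1 & h2 & h3 & h4). destruct (hd t) as (e1 & e2 & e3 & e4).
  rewrite bracket_pos_x, e3 in h1. rewrite bracket_pos_y, e4 in h2.
  rewrite bracket_vel_x, e1 in h3. rewrite bracket_vel_y, e2, e in h4.
  split; [exact h1 | split; [|split; [exact h3|]]].
  + change (is_derive (fun s => (pos_y (g s) - a) / sqrt (1 + a ^ 2)) t
      (vel_y (g t) / sqrt (1 + a ^ 2))).
    apply (is_derive_ext (fun s => / sqrt (1 + a ^ 2) * (pos_y (g s) - a)));
      [intros; unfold Rdiv; apply Rmult_comm|].
    replace (vel_y (g t) / sqrt (1 + a ^ 2)) with (/ sqrt (1 + a ^ 2) * (vel_y (g t) - 0))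
      by (field; lra).
    apply (is_derive_scal (fun s => pos_y (g s) - a)).
    apply (is_derive_minus (fun s => pos_y (g s)) (fun _ => a));
      [exact h2 | apply (@is_derive_const R_AbsRing R_NormedModule)].
  + change (is_derive (fun s => vel_y (g s) / sqrt (1 + a ^ 2)) t
      (- (m * qy (flat a (g t)) / radius (flat a (g t)) ^ 3))).
    apply (is_derive_ext (fun s => / sqrt (1 + a ^ 2) * vel_y (g s)));
      [intros; unfold Rdiv; apply Rmult_comm|].
    evar_last.
    * apply (is_derive_scal (fun s => vel_y (g s))). exact h4.
    * field. split; [|apply Rgt_not_eq, hs]. apply Rgt_not_eq, hr.
- intros h t.
  destruct (h t) as (_ & h1 & h2 & h3 & h4). destruct (hd t) as (e1 & e2 & e3 & e4).
  rewrite bracket_pos_x, e3, bracket_pos_y, e4, bracket_vel_x, e1, bracket_vel_y, e2, e.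
  split; [exact h1 | split; [|split; [exact h3|]]].
  + apply (is_derive_ext (fun s => sqrt (1 + a ^ 2) * qy (flat a (g s)) + a));
      [intros; cbn [qy flat]; unfold eta;
       match goal with |- ?A = ?B => change (A = B :> R) end; field; lra|].
    replace (vel_y (g t)) with (sqrt (1 + a ^ 2) * py (flat a (g t)) + 0)
      by (cbn [py flat]; unfold eta_dot; field; lra).
    apply (is_derive_plus (fun s => sqrt (1 + a ^ 2) * qy (flat a (g s))) (fun _ => a));
      [|apply (@is_derive_const R_AbsRing R_NormedModule)].
    apply (is_derive_scal (fun s => qy (flat a (g s)))). exact h2.
  + apply (is_derive_ext (fun s => sqrt (1 + a ^ 2) * py (flat a (g s))));
      [intros; cbn [py flat]; unfold eta_dot;
       match goal with |- ?A = ?B => change (A = B :> R) end; field; lra|].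
    evar_last.
    * apply (is_derive_scal (fun s => py (flat a (g s)))). exact h4.
    * ring.
Qed.

(** * The flow, its period and the average *)

Lemma radius_pos_of_ang (z : phase) : ang z <> 0 -> 0 < radius z.
Proof.
intros h. destruct (sqrt_pos (qx z ^ 2 + qy z ^ 2)) as [h0 | h0]; [exact h0|].
exfalso; apply h.
assert (h2 := radius_sq z). unfold radius in h2. rewrite <- h0 in h2.
assert (hx : qx z = 0) by (generalize (pow2_ge_0 (qx z)) (pow2_ge_0 (qy z)); nra).
assert (hy : qy z = 0) by (generalize (pow2_ge_0 (qx z)) (pow2_ge_0 (qy z)); nra).
unfold ang. rewrite hx, hy. ring.
Qed.

Lemma orbit_0 (m : R) (z : phase) (hb : 0 < bind m z) (hc : ang z <> 0) : orbit m z 0 = z.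
Proof.
assert (hr := radius_pos_of_ang z hc). assert (hk := freq_pos m z hb).
unfold orbit, orb_x, orb_y, orb_x', orb_y', orb_r, harm, rad_cos, cos_x, cos_y, sin_x, sin_y.
rewrite cos_0, sin_0. destruct z as [x y u v]. cbn [qx qy px py] in *.
f_equal; try ring; field; split; lra.
Qed.

Lemma orb_t_0 (m : R) (z : phase) : orb_t m z 0 = 0.
Proof. unfold orb_t. rewrite cos_0, sin_0. unfold Rdiv. ring. Qed.

(** Inverting Kepler's equation produces a motion, so the one picked by [epsilon] is a motion too,
    and uniqueness identifies the two. *)
Lemma kepler_flow_orbit (a m : R) (z : TR2) (hm : 0 < m) (hb : 0 < bind m (flat a z))
  (hc : ang (flat a z) <> 0) :
  exists th, (forall t, orb_t m (flat a z) (th t) = t) /\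
    (forall s, th (orb_t m (flat a z) s) = s) /\
    (forall t, is_derive th t (freq m (flat a z) / orb_r m (flat a z) (th t))) /\
    (forall t, flat a (kepler_flow a m t z) = orbit m (flat a z) (th t)).
Proof.
set (Z := flat a z) in *.
assert (hr := radius_pos_of_ang Z hc). assert (hk := freq_pos m Z hb).
destruct (orb_r_lower m Z hm hr hb hc) as (mu & hmu & hlow).
destruct (increasing_bijection (orb_t m Z) (fun s => orb_r m Z s / freq m Z) (mu / freq m Z))
  as (th & h1 & h2 & h3).
{ now apply Rdiv_lt_0_compat. }
{ apply is_derive_orb_t. }
{ intros s. apply Rmult_le_compat_r; [apply Rlt_le, Rinv_0_lt_compat, hk | apply hlow]. }
exists th; split; [exact h1 | split; [exact h2|]].
assert (h4 : forall t, is_derive th t (freq m Z / orb_r m Z (th t))).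
{ intros t. replace (freq m Z / orb_r m Z (th t)) with (/ (orb_r m Z (th t) / freq m Z)).
  - apply h3.
  - field. generalize (hlow (th t)); lra. }
split; [exact h4|].
assert (hex : exists g, is_kepler_motion a m z g).
{ exists (fun t => unflat a (orbit m Z (th t))).
  assert (hpos : forall t, 0 < radius (flat a (unflat a (orbit m Z (th t))))).
  { intros t. rewrite flat_unflat, radius_orbit by assumption. now apply orb_r_pos. }
  split; [|split].
  - rewrite <- (orb_t_0 m Z), h2, orbit_0 by assumption. apply unflat_flat.
  - apply integral_curve_flat; [exact hpos|].
    intros t. generalize (orbit_is_motion m Z th hm hr hb hc h4 t).
    unfold is_motion. intros (k1 & k2 & k3 & k4 & k5).
    rewrite flat_unflat.
    split; [exact k1 | split; [|split; [|split]]];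
      (eapply is_derive_ext; [intros s; rewrite flat_unflat; reflexivity | assumption]).
  - intros t. apply radius_flat_ne, hpos. }
assert (hflow : is_kepler_motion a m z (fun t => kepler_flow a m t z))
  by exact (epsilon_spec _ _ hex).
destruct hflow as (g0 & g1 & g2).
assert (hgm : is_motion m (fun t => flat a (kepler_flow a m t z))).
{ apply (integral_curve_flat a m (fun t => kepler_flow a m t z)); [|exact g1].
  intros t. apply radius_flat_pos, g2. }
cbv beta in g0.
destruct (motion_is_orbit m (fun t => flat a (kepler_flow a m t z)) hm) as (th' & k1 & k2).
- cbv beta. rewrite g0. exact hb.
- cbv beta. rewrite g0. exact hc.
- exact hgm.
- cbv beta in k1, k2. rewrite g0 in k1, k2. fold Z in k1, k2.
  (* Both anomalies solve Kepler's equation, and [th] inverts [orb_t]. *)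
  intros t. rewrite k1. f_equal. rewrite <- (h2 (th' t)), k2. reflexivity.
Qed.

Lemma orb_t_increasing (m : R) (z : phase) (hm : 0 < m) (hb : 0 < bind m z) (hc : ang z <> 0)
  (s s' : R) : s < s' -> orb_t m z s < orb_t m z s'.
Proof.
intros h. assert (hr := radius_pos_of_ang z hc). assert (hk := freq_pos m z hb).
destruct (MVT_gen (orb_t m z) s s' (fun s => orb_r m z s / freq m z)) as (c & _ & hc').
- intros; apply is_derive_orb_t.
- intros t _. apply derivable_continuous_pt. eexists. apply is_derive_Reals, is_derive_orb_t.
- assert (0 < orb_r m z c / freq m z) by (apply Rdiv_lt_0_compat; [apply orb_r_pos|]; assumption).
  assert (0 < orb_r m z c / freq m z * (s' - s)) by (apply Rmult_lt_0_compat; lra).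
  lra.
Qed.

Lemma orb_t_2PI (m : R) (z : phase) : orb_t m z (2 * PI) = 2 * PI * rad_0 m z / freq m z.
Proof. unfold orb_t. rewrite cos_2PI, sin_2PI. unfold Rdiv. ring. Qed.

(** A return to the initial state means that rotation by [s] fixes (q - c, q') in each coordinate.
    Nonzero angular momentum provides a coordinate with q' nonzero, which forces cos s = 1. *)
Lemma orbit_simple (m : R) (z : phase) (s : R) (hm : 0 < m) (hb : 0 < bind m z)
  (hc : ang z <> 0) (hs : 0 < s < 2 * PI) : orbit m z s <> z.
Proof.
intros e.
assert (hr := radius_pos_of_ang z hc). assert (hk := freq_pos m z hb).
assert (eR : orb_r m z s = radius z) by (rewrite <- (radius_orbit m z s), e; trivial).
assert (ex : orb_x m z s = qx z) by (rewrite <- e at 2; reflexivity).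
assert (ey : orb_y m z s = qy z) by (rewrite <- e at 2; reflexivity).
assert (eu : freq m z * orb_x' m z s / radius z = px z)
  by (rewrite <- eR; rewrite <- e at 4; reflexivity).
assert (ev : freq m z * orb_y' m z s / radius z = py z)
  by (rewrite <- eR; rewrite <- e at 4; reflexivity).
assert (eu' : orb_x' m z s = sin_x m z) by (unfold sin_x; rewrite <- eu; field; lra).
assert (ev' : orb_y' m z s = sin_y m z) by (unfold sin_y; rewrite <- ev; field; lra).
assert (h2 := cos_sin_sq s).
assert (hrot : forall c p q, harm c p q s = c + p -> harm 0 q (- p) s = q -> q <> 0 -> cos s = 1).
{ unfold harm. intros c p q e1 e2 hq.
  assert (e3 : q * (2 - 2 * cos s) = 0).
  { transitivity (q * (cos s ^ 2 + sin s ^ 2 + 1 - 2 * cos s)); [rewrite h2; ring|].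
    transitivity ((q - q * cos s + p * sin s) * (1 - cos s)
       + (p * cos s + q * sin s - p) * sin s); [ring|].
    replace (q - q * cos s + p * sin s) with 0 by lra.
    replace (p * cos s + q * sin s - p) with 0 by lra. ring. }
  destruct (Rmult_integral _ _ e3); [contradiction | lra]. }
assert (hcos : cos s = 1).
{ destruct (Req_dec (sin_x m z) 0) as [ebx | ebx].
  - destruct (Req_dec (sin_y m z) 0) as [eby | eby].
    + exfalso; apply hc.
      assert (epx : px z = 0) by (rewrite <- eu, eu', ebx; field; lra).
      assert (epy : py z = 0) by (rewrite <- ev, ev', eby; field; lra).
      unfold ang. rewrite epx, epy. ring.
    + apply (hrot (center_y m z) (cos_y m z) (sin_y m z)); [|exact ev'|exact eby].
      transitivity (qy z); [exact ey | unfold cos_y; ring].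
  - apply (hrot (center_x m z) (cos_x m z) (sin_x m z)); [|exact eu'|exact ebx].
    transitivity (qx z); [exact ex | unfold cos_x; ring]. }
assert (hsin : sin s = 0) by (rewrite hcos in h2; nra).
destruct (sin_eq_O_2PI_0 s) as [e0 | [e0 | e0]]; try lra.
rewrite e0, cos_PI in hcos. lra.
Qed.

(** Of two distinct minimal periods the smaller would be an early return forbidden by the larger, so
    the choice made by [epsilon] is determined. *)
Lemma kepler_period_eq (a m : R) (z : TR2) (hm : 0 < m) (hb : 0 < bind m (flat a z))
  (hc : ang (flat a z) <> 0) : kepler_period a m z = orb_t m (flat a z) (2 * PI).
Proof.
destruct (kepler_flow_orbit a m z hm hb hc) as (th & h1 & h2 & _ & h4).
set (Z := flat a z) in *.
assert (hper : is_minimal_period a m z (orb_t m Z (2 * PI))).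
{ split; [|split].
  - rewrite <- (orb_t_0 m Z). apply orb_t_increasing; trivial. generalize PI_RGT_0; lra.
  - rewrite <- (unflat_flat a (kepler_flow a m _ z)), h4, h2, <- (unflat_flat a z).
    f_equal. fold Z. rewrite <- (orbit_0 m Z) at 2 by assumption.
    unfold orbit, orb_x, orb_y, orb_x', orb_y', orb_r, harm.
    now rewrite cos_2PI, sin_2PI, cos_0, sin_0.
  - intros t ht e. apply (orbit_simple m Z (th t)); trivial.
    + rewrite <- (h1 t), <- (orb_t_0 m Z) in ht.
      split; apply Rnot_le_lt; intros [h | h].
      * apply (orb_t_increasing m Z hm hb hc) in h. lra.
      * rewrite h in ht. lra.
      * apply (orb_t_increasing m Z hm hb hc) in h. lra.
      * rewrite h in ht. lra.
    + rewrite <- h4, e. reflexivity. }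
assert (hper' : is_minimal_period a m z (kepler_period a m z))
  by exact (epsilon_spec _ _ (ex_intro _ _ hper)).
destruct hper as (p1 & p2 & p3), hper' as (q1 & q2 & q3).
destruct (Rtotal_order (kepler_period a m z) (orb_t m Z (2 * PI))) as [h | [h | h]].
- exfalso. now apply (p3 (kepler_period a m z)).
- exact h.
- exfalso. now apply (q3 (orb_t m Z (2 * PI))).
Qed.

(** * The potential and its average in the eccentric anomaly *)

Definition dist2 (e x y : R) : R := sqrt (x ^ 2 + (y + 2 * e) ^ 2).
Definition pot (e m2 f x y : R) : R :=
  - (m2 / dist2 e x y) + f * (x ^ 2 + (y + e) ^ 2).

Lemma V_Eucl_2_flat (a m2 f : R) (z : TR2) :
  V_Eucl_2 a m2 f z
  = pot (a / sqrt (1 + a ^ 2)) m2 f (qx (flat a z)) (qy (flat a z)).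
Proof.
assert (hs := scale_pos a).
unfold V_Eucl_2, pot, dist2. rewrite norm_a_flat. cbn [qx qy flat]. unfold xi, eta.
f_equal.
- do 4 f_equal. f_equal. field. lra.
- do 2 f_equal. transitivity ((pos_y z / sqrt (1 + a ^ 2)) ^ 2).
  + unfold Rdiv. now rewrite Rpow_mult_distr, pow_inv, scale_sq.
  + f_equal. field. lra.
Qed.

Lemma is_derive_pot (e m2 f : R) (X Y : R -> R) (t x' y' : R) (h : 0 < dist2 e (X t) (Y t))
  (hx : is_derive X t x') (hy : is_derive Y t y') :
  is_derive (fun s => pot e m2 f (X s) (Y s)) t
    ((m2 * X t / dist2 e (X t) (Y t) ^ 3 + 2 * f * X t) * x'
     + (m2 * (Y t + 2 * e) / dist2 e (X t) (Y t) ^ 3 + 2 * f * (Y t + e)) * y').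
Proof.
assert (h' : 0 < X t ^ 2 + (Y t + 2 * e) ^ 2)
  by (apply sqrt_lt_0_alt; rewrite sqrt_0; exact h).
unfold pot, dist2 in *. auto_derive.
- repeat split; try (eexists; eassumption); [exact h' | apply Rgt_not_eq; exact h].
- rewrite_derivatives. set (r := sqrt (X t ^ 2 + (Y t + 2 * e) ^ 2)) in *.
  match goal with |- context [/ (2 * ?q)] => change q with r end.
  clearbody r. field. lra.
Qed.

(** One turn is a compact interval, as [positive_tube] requires, and contains all that the integral
    sees. *)
Definition avoids (m e : R) (z : phase) : Prop :=
  forall s, 0 <= s <= 2 * PI -> 0 < dist2 e (orb_x m z s) (orb_y m z s).

(** Substitution t = [orb_t] s. The period is 2 pi rad_0 / freq and dt contributes 1 / freq, so freq
    cancels and the prefactor is 1 / (2 pi rad_0) = bind / (2 pi m). *)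
Lemma average_eq (a m m2 f : R) (z : TR2) (hm : 0 < m) (hb : 0 < bind m (flat a z))
  (hc : ang (flat a z) <> 0) (ha : avoids m (a / sqrt (1 + a ^ 2)) (flat a z)) :
  average a m (V_Eucl_2 a m2 f) z
  = bind m (flat a z) / (2 * PI * m)
    * RInt (fun s => pot (a / sqrt (1 + a ^ 2)) m2 f (orb_x m (flat a z) s) (orb_y m (flat a z) s)
        * orb_r m (flat a z) s) 0 (2 * PI).
Proof.
destruct (kepler_flow_orbit a m z hm hb hc) as (th & h1 & h2 & h3 & h4).
unfold average. rewrite kepler_period_eq by assumption.
set (e := a / sqrt (1 + a ^ 2)) in *. set (Z := flat a z) in *.
assert (hk := freq_pos m Z hb). assert (hpi := PI_RGT_0).
set (F := fun t => pot e m2 f (orb_x m Z (th t)) (orb_y m Z (th t))).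
assert (hF : forall t, V_Eucl_2 a m2 f (kepler_flow a m t z) = F t).
{ intros t. rewrite V_Eucl_2_flat, h4. reflexivity. }
rewrite (RInt_ext _ F) by (intros; apply hF).
replace (RInt F 0) with (RInt F (orb_t m Z 0)) by (now rewrite orb_t_0).
rewrite <- (RInt_comp F (orb_t m Z) (fun s => orb_r m Z s / freq m Z)).
- rewrite (RInt_ext _ (fun s => / freq m Z
    * (pot e m2 f (orb_x m Z s) (orb_y m Z s) * orb_r m Z s))).
  + rewrite (RInt_scal (V := R_CompleteNormedModule)), orb_t_2PI.
    * change scal with Rmult. unfold rad_0. field. repeat split; lra.
    * apply (@ex_RInt_continuous R_CompleteNormedModule). intros s hs.
      rewrite Rmin_left, Rmax_right in hs by lra.
      apply (ex_derive_continuous (fun s => pot e m2 f (orb_x m Z s) (orb_y m Z s) * orb_r m Z s)).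
      apply (ex_derive_mult (fun s => pot e m2 f (orb_x m Z s) (orb_y m Z s)) (orb_r m Z)).
      { eexists. eapply (is_derive_pot e m2 f (orb_x m Z) (orb_y m Z) s _ _ (ha s hs));
          apply is_derive_harm. }
      { eexists. apply is_derive_harm. }
  + intros s _. unfold F. rewrite h2. change scal with Rmult.
    match goal with |- ?A = ?B => change (A = B :> R) end. field. lra.
- intros s hs. rewrite Rmin_left, Rmax_right in hs by lra.
  apply (ex_derive_continuous F).
  eexists. unfold F. eapply (is_derive_pot e m2 f (fun t => orb_x m Z (th t))
    (fun t => orb_y m Z (th t))).
  + rewrite h2. now apply ha.
  + apply (is_derive_comp (orb_x m Z) th); [apply is_derive_harm | apply h3].
  + apply (is_derive_comp (orb_y m Z) th); [apply is_derive_harm | apply h3].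
- intros s _. split; [apply is_derive_orb_t|].
  apply (ex_derive_continuous (fun s => orb_r m Z s / freq m Z)).
  unfold orb_r, harm. auto_derive. exact I.
Qed.

(** * Variation of the orbital elements along a line *)

Definition potx (e m2 f x y : R) : R := m2 * x / dist2 e x y ^ 3 + 2 * f * x.
Definition poty (e m2 f x y : R) : R :=
  m2 * (y + 2 * e) / dist2 e x y ^ 3 + 2 * f * (y + e).

(** Used both for the line along which one differentiates and, on directions, for the linear
    combination z + s d. *)
Definition line (z d : phase) (s : R) : phase :=
  Phase (qx z + s * qx d) (qy z + s * qy d) (px z + s * px d) (py z + s * py d).

(** From here on, [d_] marks the directional derivative at [z] along [d], written so that it is
    linear in [d]. *)
Definition d_rad (z d : phase) : R := (qx z * qx d + qy z * qy d) / radius z.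
Definition d_bind (m : R) (z d : phase) : R :=
  - (2 * m * d_rad z d / radius z ^ 2) - 2 * (px z * px d + py z * py d).
Definition d_ang (z d : phase) : R :=
  qx d * py z + qx z * py d - (qy d * px z + qy z * px d).
Definition d_lrl_x (m : R) (z d : phase) : R :=
  d_ang z d * py z + ang z * py d - m * qx d / radius z + m * qx z * d_rad z d / radius z ^ 2.
Definition d_lrl_y (m : R) (z d : phase) : R :=
  - (d_ang z d * px z + ang z * px d) - m * qy d / radius z
  + m * qy z * d_rad z d / radius z ^ 2.
Definition d_freq (m : R) (z d : phase) : R := d_bind m z d / (2 * freq m z).
Definition d_center_x (m : R) (z d : phase) : R :=
  - d_lrl_x m z d / bind m z + lrl_x m z * d_bind m z d / bind m z ^ 2.
Definition d_center_y (m : R) (z d : phase) : R :=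
  - d_lrl_y m z d / bind m z + lrl_y m z * d_bind m z d / bind m z ^ 2.
Definition d_cos_x (m : R) (z d : phase) : R := qx d - d_center_x m z d.
Definition d_cos_y (m : R) (z d : phase) : R := qy d - d_center_y m z d.
Definition d_sin_x (m : R) (z d : phase) : R :=
  (d_rad z d * px z + radius z * px d) / freq m z
  - radius z * px z * d_freq m z d / freq m z ^ 2.
Definition d_sin_y (m : R) (z d : phase) : R :=
  (d_rad z d * py z + radius z * py d) / freq m z
  - radius z * py z * d_freq m z d / freq m z ^ 2.
Definition d_rad_0 (m : R) (z d : phase) : R := - (m * d_bind m z d / bind m z ^ 2).
Definition d_rad_cos (m : R) (z d : phase) : R := d_rad z d - d_rad_0 m z d.
Definition d_rad_sin (m : R) (z d : phase) : R :=
  (qx d * px z + qx z * px d + (qy d * py z + qy z * py d)) / freq m z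
  - (qx z * px z + qy z * py z) * d_freq m z d / freq m z ^ 2.

Definition integrand (e m m2 f : R) (z : phase) (t : R) : R :=
  pot e m2 f (orb_x m z t) (orb_y m z t) * orb_r m z t.
Definition d_integrand (e m m2 f : R) (z d : phase) (t : R) : R :=
  (potx e m2 f (orb_x m z t) (orb_y m z t)
     * harm (d_center_x m z d) (d_cos_x m z d) (d_sin_x m z d) t
   + poty e m2 f (orb_x m z t) (orb_y m z t)
     * harm (d_center_y m z d) (d_cos_y m z d) (d_sin_y m z d) t)
  * orb_r m z t
  + pot e m2 f (orb_x m z t) (orb_y m z t)
    * harm (d_rad_0 m z d) (d_rad_cos m z d) (d_rad_sin m z d) t.

Lemma line_0 (z d : phase) : line z d 0 = z.
Proof. destruct z as [x y u v]; unfold line; cbn [qx qy px py]. f_equal; ring. Qed.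

Lemma der_const (c t : R) : is_derive (fun _ : R => c) t 0.
Proof. apply (@is_derive_const R_AbsRing R_NormedModule). Qed.
Lemma der_add (f g : R -> R) (t a b : R) :
  is_derive f t a -> is_derive g t b -> is_derive (fun s => f s + g s) t (a + b).
Proof. apply (@is_derive_plus R_AbsRing R_NormedModule). Qed.
Lemma der_sub (f g : R -> R) (t a b : R) :
  is_derive f t a -> is_derive g t b -> is_derive (fun s => f s - g s) t (a - b).
Proof. apply (@is_derive_minus R_AbsRing R_NormedModule). Qed.
Lemma der_opp (f : R -> R) (t a : R) :
  is_derive f t a -> is_derive (fun s => - f s) t (- a).
Proof. apply (@is_derive_opp R_AbsRing R_NormedModule). Qed.
Lemma der_mul (f g : R -> R) (t a b : R) :
  is_derive f t a -> is_derive g t b -> is_derive (fun s => f s * g s) t (a * g t + f t * b).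
Proof. intros h1 h2. apply (is_derive_mult f g t a b h1 h2), Rmult_comm. Qed.
Lemma der_div (f g : R -> R) (t a b : R) (h : g t <> 0) :
  is_derive f t a -> is_derive g t b ->
  is_derive (fun s => f s / g s) t ((a * g t - f t * b) / g t ^ 2).
Proof. intros h1 h2. now apply is_derive_div. Qed.
Lemma der_sq (f : R -> R) (t a : R) :
  is_derive f t a -> is_derive (fun s => f s ^ 2) t (2 * f t * a).
Proof.
intros h. evar_last; [apply (is_derive_pow f 2 t a h) | simpl; ring].
Qed.

Ltac der_step :=
  first
  [ match goal with
    | h : is_derive ?f ?t _ |- is_derive ?f ?t _ => exact h
    | |- is_derive (fun s => ?c) _ _ => apply (der_const c)
    | |- is_derive (fun s => @?A s + @?B s) _ _ => apply (der_add A B)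
    | |- is_derive (fun s => @?A s - @?B s) _ _ => apply (der_sub A B)
    | |- is_derive (fun s => - @?A s) _ _ => apply (der_opp A)
    | |- is_derive (fun s => @?A s * @?B s) _ _ => apply (der_mul A B)
    | |- is_derive (fun s => @?A s / @?B s) _ _ => apply (der_div A B)
    | |- is_derive (fun s => @?A s ^ 2) _ _ => apply (der_sq A)
    end
  | eassumption ].
Ltac der := evar_last; [repeat der_step; cbv beta |].

(** Stated at every point of the line and not only at s = 0, since differentiation under the
    integral needs the derivative in a neighbourhood. *)
Lemma line_derivatives (m : R) (z d : phase) (s : R) (w := line z d s)
  (hr : 0 < radius w) (hb : 0 < bind m w) :
  is_derive (fun s => bind m (line z d s)) s (d_bind m w d) /\
  is_derive (fun s => center_x m (line z d s)) s (d_center_x m w d) /\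
  is_derive (fun s => center_y m (line z d s)) s (d_center_y m w d) /\
  is_derive (fun s => cos_x m (line z d s)) s (d_cos_x m w d) /\
  is_derive (fun s => cos_y m (line z d s)) s (d_cos_y m w d) /\
  is_derive (fun s => sin_x m (line z d s)) s (d_sin_x m w d) /\
  is_derive (fun s => sin_y m (line z d s)) s (d_sin_y m w d) /\
  is_derive (fun s => rad_0 m (line z d s)) s (d_rad_0 m w d) /\
  is_derive (fun s => rad_cos m (line z d s)) s (d_rad_cos m w d) /\
  is_derive (fun s => rad_sin m (line z d s)) s (d_rad_sin m w d).
Proof.
assert (hk := freq_pos m w hb). assert (hk2 := freq_sq m w hb).
assert (hx : is_derive (fun s => qx (line z d s)) s (qx d))
  by (cbn [qx line]; auto_derive; [exact I | ring]).
assert (hy : is_derive (fun s => qy (line z d s)) s (qy d))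
  by (cbn [qy line]; auto_derive; [exact I | ring]).
assert (hu : is_derive (fun s => px (line z d s)) s (px d))
  by (cbn [px line]; auto_derive; [exact I | ring]).
assert (hv : is_derive (fun s => py (line z d s)) s (py d))
  by (cbn [py line]; auto_derive; [exact I | ring]).
assert (hrad : is_derive (fun s => radius (line z d s)) s (d_rad w d))
  by (apply (is_derive_norm (fun s => qx (line z d s)) (fun s => qy (line z d s))); assumption).
assert (hbd : is_derive (fun s => bind m (line z d s)) s (d_bind m w d)).
{ unfold bind at 1. der; [fold w; lra|]. fold w. unfold d_bind. field. lra. }
assert (hfr : is_derive (fun s => freq m (line z d s)) s (d_freq m w d)).
{ evar_last.
  - apply (is_derive_comp sqrt (fun s => bind m (line z d s))); [|exact hbd].
    apply is_derive_Reals, derivable_pt_lim_sqrt, hb.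
  - fold w. unfold d_freq. change scal with Rmult. change (sqrt (bind m w)) with (freq m w).
    match goal with |- ?A = ?B => change (A = B :> R) end. field. lra. }
assert (hang : is_derive (fun s => ang (line z d s)) s (d_ang w d)).
{ unfold ang at 1. der. fold w. unfold d_ang. ring. }
assert (hl1 : is_derive (fun s => lrl_x m (line z d s)) s (d_lrl_x m w d)).
{ unfold lrl_x. der; [fold w; lra|]. fold w. unfold d_lrl_x. field. lra. }
assert (hl2 : is_derive (fun s => lrl_y m (line z d s)) s (d_lrl_y m w d)).
{ unfold lrl_y. der; [fold w; lra|]. fold w. unfold d_lrl_y. field. lra. }
assert (hcx : is_derive (fun s => center_x m (line z d s)) s (d_center_x m w d)).
{ unfold center_x. der; [fold w; lra|]. fold w. unfold d_center_x. field. lra. }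
assert (hcy : is_derive (fun s => center_y m (line z d s)) s (d_center_y m w d)).
{ unfold center_y. der; [fold w; lra|]. fold w. unfold d_center_y. field. lra. }
assert (hal : is_derive (fun s => rad_0 m (line z d s)) s (d_rad_0 m w d)).
{ unfold rad_0. der; [fold w; lra|]. fold w. unfold d_rad_0. field. lra. }
split; [exact hbd | split; [exact hcx | split; [exact hcy|]]].
split; [unfold cos_x; der; reflexivity | split; [unfold cos_y; der; reflexivity|]].
split; [unfold sin_x; der; [fold w; lra | fold w; unfold d_sin_x; field; lra]|].
split; [unfold sin_y; der; [fold w; lra | fold w; unfold d_sin_y; field; lra]|].
split; [exact hal | split; [unfold rad_cos; der; reflexivity|]].
unfold rad_sin; der; [fold w; lra | fold w; unfold d_rad_sin; field; lra].
Qed.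

(** * Differentiation under the integral sign *)

Lemma continuity_2d_pt_div (f g : R -> R -> R) (x y : R) (h : g x y <> 0) :
  continuity_2d_pt f x y -> continuity_2d_pt g x y ->
  continuity_2d_pt (fun u v => f u v / g u v) x y.
Proof.
intros hf hg. apply (continuity_2d_pt_mult f (fun u v => / g u v)); [exact hf|].
now apply continuity_2d_pt_inv.
Qed.

Lemma continuity_2d_pt_pow (f : R -> R -> R) (n : nat) (x y : R) :
  continuity_2d_pt f x y -> continuity_2d_pt (fun u v => f u v ^ n) x y.
Proof.
intros hf. induction n as [|n IH].
- exact (continuity_2d_pt_const x y 1).
- apply (continuity_2d_pt_mult f (fun u v => f u v ^ n)); assumption.
Qed.

Lemma continuity_2d_pt_sqrt (f : R -> R -> R) (x y : R) :
  continuity_2d_pt f x y -> 0 <= f x y -> continuity_2d_pt (fun u v => sqrt (f u v)) x y.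
Proof.
intros hf h. apply (continuity_1d_2d_pt_comp sqrt f); [|exact hf].
now apply continuity_pt_sqrt.
Qed.

Lemma continuity_2d_pt_cos (x y : R) : continuity_2d_pt (fun _ v => cos v) x y.
Proof.
apply (continuity_1d_2d_pt_comp cos (fun _ v => v)); [apply continuity_cos|].
apply continuity_2d_pt_id2.
Qed.

Lemma continuity_2d_pt_sin (x y : R) : continuity_2d_pt (fun _ v => sin v) x y.
Proof.
apply (continuity_1d_2d_pt_comp sin (fun _ v => v)); [apply continuity_sin|].
apply continuity_2d_pt_id2.
Qed.

Lemma continuity_2d_pt_pos (f : R -> R -> R) (x y : R)
  (hf : continuity_2d_pt f x y) (h : 0 < f x y) :
  locally_2d (fun u v => 0 < f u v) x y.
Proof.
destruct (hf (mkposreal _ h)) as (delta & hd).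
exists delta. intros u v hu hv. generalize (hd u v hu hv); simpl; intros hlt.
apply Rabs_lt_between in hlt. lra.
Qed.

Lemma continuity_2d_pt_slice (f : R -> R -> R) (x y : R) (hf : continuity_2d_pt f x y) :
  continuity_pt (f x) y.
Proof.
apply continuity_pt_locally. intros eps.
apply (locally_2d_1d_const_x (fun u v => Rabs (f u v - f x y) < eps)). apply hf.
Qed.

(** On the compact interval [f x] has a positive minimum, and uniform continuity keeps [f u t]
    within that minimum of [f x t]. *)
Lemma positive_tube (f : R -> R -> R) (x a b : R) (hab : a <= b)
  (hf : forall t, a <= t <= b -> continuity_2d_pt f x t)
  (hpos : forall t, a <= t <= b -> 0 < f x t) :
  locally x (fun u => forall t, a <= t <= b -> 0 < f u t).
Proof.
destruct (continuity_ab_min (f x) a b hab) as (t0 & hmin & ht0).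
{ intros t ht. now apply continuity_2d_pt_slice, hf. }
destruct (uniform_continuity_2d_1d' f a b x hf (mkposreal _ (hpos t0 ht0))) as (delta & hd).
exists delta. intros u hu t ht.
assert (hu' : Rabs (u - x) < delta) by exact hu.
apply Rabs_lt_between in hu'.
assert (hdp := cond_pos delta).
generalize (hd t x t u ht ltac:(lra) ht ltac:(lra)).
rewrite Rminus_diag, Rabs_R0. simpl. intros hlt. specialize (hlt hdp).
apply Rabs_lt_between in hlt. generalize (hmin t ht). lra.
Qed.

Ltac cont2_step :=
  first
  [ assumption
  | match goal with
    | |- continuity_2d_pt (fun s t => ?c) _ _ => apply (continuity_2d_pt_const _ _ c)
    | |- continuity_2d_pt (fun s t => s) _ _ => apply continuity_2d_pt_id1
    | |- continuity_2d_pt (fun s t => cos t) _ _ => apply continuity_2d_pt_cos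
    | |- continuity_2d_pt (fun s t => sin t) _ _ => apply continuity_2d_pt_sin
    | |- continuity_2d_pt (fun s t => @?A s t + @?B s t) _ _ => apply (continuity_2d_pt_plus A B)
    | |- continuity_2d_pt (fun s t => @?A s t - @?B s t) _ _ => apply (continuity_2d_pt_minus A B)
    | |- continuity_2d_pt (fun s t => - @?A s t) _ _ => apply (continuity_2d_pt_opp A)
    | |- continuity_2d_pt (fun s t => @?A s t * @?B s t) _ _ => apply (continuity_2d_pt_mult A B)
    | |- continuity_2d_pt (fun s t => @?A s t / @?B s t) _ _ => apply (continuity_2d_pt_div A B)
    | |- continuity_2d_pt (fun s t => @?A s t ^ ?n) _ _ => apply (continuity_2d_pt_pow A n)
    | |- continuity_2d_pt (fun s t => sqrt (@?A s t)) _ _ => apply (continuity_2d_pt_sqrt A)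
    end ].
Ltac cont2 := repeat cont2_step; cbv beta.

Lemma line_continuity (m : R) (z d : phase) (s0 t0 : R) (w := line z d s0)
  (hr : 0 < radius w) (hb : 0 < bind m w) :
  continuity_2d_pt (fun s t => orb_x m (line z d s) t) s0 t0 /\
  continuity_2d_pt (fun s t => orb_y m (line z d s) t) s0 t0 /\
  continuity_2d_pt (fun s t => orb_r m (line z d s) t) s0 t0 /\
  continuity_2d_pt (fun s t => harm (d_center_x m (line z d s) d) (d_cos_x m (line z d s) d)
    (d_sin_x m (line z d s) d) t) s0 t0 /\
  continuity_2d_pt (fun s t => harm (d_center_y m (line z d s) d) (d_cos_y m (line z d s) d)
    (d_sin_y m (line z d s) d) t) s0 t0 /\
  continuity_2d_pt (fun s t => harm (d_rad_0 m (line z d s) d) (d_rad_cos m (line z d s) d)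
    (d_rad_sin m (line z d s) d) t) s0 t0.
Proof.
assert (hk := freq_pos m w hb).
assert (hr2 : radius w ^ 2 <> 0) by (apply pow_nonzero; lra).
assert (hb2 : bind m w ^ 2 <> 0) by (apply pow_nonzero; lra).
assert (hk2 : freq m w ^ 2 <> 0) by (apply pow_nonzero; lra).
assert (cqx : continuity_2d_pt (fun s _ => qx (line z d s)) s0 t0) by (cbn [qx line]; cont2).
assert (cqy : continuity_2d_pt (fun s _ => qy (line z d s)) s0 t0) by (cbn [qy line]; cont2).
assert (cpx : continuity_2d_pt (fun s _ => px (line z d s)) s0 t0) by (cbn [px line]; cont2).
assert (cpy : continuity_2d_pt (fun s _ => py (line z d s)) s0 t0) by (cbn [py line]; cont2).
assert (crad : continuity_2d_pt (fun s _ => radius (line z d s)) s0 t0).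
{ unfold radius. cont2. fold w. rewrite <- radius_sq. apply pow2_ge_0. }
assert (cbd : continuity_2d_pt (fun s _ => bind m (line z d s)) s0 t0).
{ unfold bind. cont2. fold w; lra. }
assert (cfr : continuity_2d_pt (fun s _ => freq m (line z d s)) s0 t0).
{ unfold freq. cont2. fold w; lra. }
assert (cang : continuity_2d_pt (fun s _ => ang (line z d s)) s0 t0) by (unfold ang; cont2).
assert (clx : continuity_2d_pt (fun s _ => lrl_x m (line z d s)) s0 t0)
  by (unfold lrl_x; cont2; fold w; lra).
assert (cly : continuity_2d_pt (fun s _ => lrl_y m (line z d s)) s0 t0)
  by (unfold lrl_y; cont2; fold w; lra).
assert (ccx : continuity_2d_pt (fun s _ => center_x m (line z d s)) s0 t0)
  by (unfold center_x; cont2; fold w; lra).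
assert (ccy : continuity_2d_pt (fun s _ => center_y m (line z d s)) s0 t0)
  by (unfold center_y; cont2; fold w; lra).
assert (cal : continuity_2d_pt (fun s _ => rad_0 m (line z d s)) s0 t0)
  by (unfold rad_0; cont2; fold w; lra).
assert (cdrad : continuity_2d_pt (fun s _ => d_rad (line z d s) d) s0 t0)
  by (unfold d_rad; cont2; fold w; lra).
assert (cdbd : continuity_2d_pt (fun s _ => d_bind m (line z d s) d) s0 t0)
  by (unfold d_bind; cont2; exact hr2).
assert (cdfr : continuity_2d_pt (fun s _ => d_freq m (line z d s) d) s0 t0)
  by (unfold d_freq; cont2; fold w; lra).
assert (cdang : continuity_2d_pt (fun s _ => d_ang (line z d s) d) s0 t0)
  by (unfold d_ang; cont2).
assert (cdlx : continuity_2d_pt (fun s _ => d_lrl_x m (line z d s) d) s0 t0)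
  by (unfold d_lrl_x; cont2; fold w; lra).
assert (cdly : continuity_2d_pt (fun s _ => d_lrl_y m (line z d s) d) s0 t0)
  by (unfold d_lrl_y; cont2; fold w; lra).
assert (cdcx : continuity_2d_pt (fun s _ => d_center_x m (line z d s) d) s0 t0)
  by (unfold d_center_x; cont2; fold w; lra).
assert (cdcy : continuity_2d_pt (fun s _ => d_center_y m (line z d s) d) s0 t0)
  by (unfold d_center_y; cont2; fold w; lra).
assert (cdal : continuity_2d_pt (fun s _ => d_rad_0 m (line z d s) d) s0 t0)
  by (unfold d_rad_0; cont2; fold w; lra).
repeat split.
- unfold orb_x, harm, cos_x, sin_x. cont2. fold w; lra.
- unfold orb_y, harm, cos_y, sin_y. cont2. fold w; lra.
- unfold orb_r, harm, rad_cos, rad_sin. cont2. fold w; lra.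
- unfold harm, d_cos_x, d_sin_x. cont2; fold w; lra.
- unfold harm, d_cos_y, d_sin_y. cont2; fold w; lra.
- unfold harm, d_rad_cos, d_rad_sin. cont2; fold w; lra.
Qed.

Lemma is_derive_integrand (e m m2 f : R) (z d : phase) (s t : R) (w := line z d s)
  (hr : 0 < radius w) (hb : 0 < bind m w)
  (hd : 0 < dist2 e (orb_x m w t) (orb_y m w t)) :
  is_derive (fun s => integrand e m m2 f (line z d s) t) s (d_integrand e m m2 f w d t).
Proof.
destruct (line_derivatives m z d s hr hb)
  as (_ & h1 & h2 & h3 & h4 & h5 & h6 & h7 & h8 & h9).
fold w in h1, h2, h3, h4, h5, h6, h7, h8, h9.
assert (hx : is_derive (fun s => orb_x m (line z d s) t) s
  (harm (d_center_x m w d) (d_cos_x m w d) (d_sin_x m w d) t)).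
{ unfold orb_x, harm. der. ring. }
assert (hy : is_derive (fun s => orb_y m (line z d s) t) s
  (harm (d_center_y m w d) (d_cos_y m w d) (d_sin_y m w d) t)).
{ unfold orb_y, harm. der. ring. }
assert (hR : is_derive (fun s => orb_r m (line z d s) t) s
  (harm (d_rad_0 m w d) (d_rad_cos m w d) (d_rad_sin m w d) t)).
{ unfold orb_r, harm. der. ring. }
unfold integrand.
assert (hp := is_derive_pot e m2 f (fun s => orb_x m (line z d s) t)
  (fun s => orb_y m (line z d s) t) s _ _ hd hx hy).
der. reflexivity.
Qed.

Lemma integrand_regular (e m m2 f : R) (z d : phase) (t : R)
  (hd : 0 < dist2 e (orb_x m z t) (orb_y m z t)) :
  continuous (integrand e m m2 f z) t /\ continuous (d_integrand e m m2 f z d) t.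
Proof.
assert (hx := is_derive_harm (center_x m z) (cos_x m z) (sin_x m z) t).
assert (hy := is_derive_harm (center_y m z) (cos_y m z) (sin_y m z) t).
assert (hR := is_derive_harm (rad_0 m z) (rad_cos m z) (rad_sin m z) t).
fold (orb_x m z) in hx. fold (orb_y m z) in hy. fold (orb_r m z) in hR.
assert (hp := is_derive_pot e m2 f (orb_x m z) (orb_y m z) t _ _ hd hx hy).
assert (h1 := is_derive_harm (d_center_x m z d) (d_cos_x m z d) (d_sin_x m z d) t).
assert (h2 := is_derive_harm (d_center_y m z d) (d_cos_y m z d) (d_sin_y m z d) t).
assert (h3 := is_derive_harm (d_rad_0 m z d) (d_rad_cos m z d) (d_rad_sin m z d) t).
assert (hq : is_derive (fun t => dist2 e (orb_x m z t) (orb_y m z t)) t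
   ((orb_x m z t * orb_x' m z t + (orb_y m z t + 2 * e) * orb_y' m z t)
    / dist2 e (orb_x m z t) (orb_y m z t))).
{ apply (is_derive_norm (orb_x m z) (fun t => orb_y m z t + 2 * e) t); [exact hd | exact hx|].
  der. apply Rplus_0_r. }
split.
- apply (ex_derive_continuous (integrand e m m2 f z)). eexists. unfold integrand.
  repeat der_step.
- apply (ex_derive_continuous (d_integrand e m m2 f z d)). eexists.
  unfold d_integrand, potx, poty.
  assert (hq3 : is_derive (fun t => dist2 e (orb_x m z t) (orb_y m z t) ^ 3) t _)
    by exact (is_derive_pow _ 3 _ _ hq).
  repeat der_step; apply pow_nonzero; apply Rgt_not_eq, hd.
Qed.

(** * The averaged potential and its directional derivative *)

Definition avg (e m m2 f : R) (z : phase) : R :=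
  bind m z / (2 * PI * m) * RInt (integrand e m m2 f z) 0 (2 * PI).
Definition d_avg (e m m2 f : R) (z d : phase) : R :=
  d_bind m z d / (2 * PI * m) * RInt (integrand e m m2 f z) 0 (2 * PI)
  + bind m z / (2 * PI * m) * RInt (d_integrand e m m2 f z d) 0 (2 * PI).

(** The conditions behind the closed formula of the average are open along lines; avoidance concerns
    a whole turn and therefore needs [positive_tube]. *)
Lemma line_near (e m : R) (z d : phase) (hb : 0 < bind m z) (hc : ang z <> 0)
  (hav : avoids m e z) :
  locally 0 (fun s => 0 < bind m (line z d s) /\ ang (line z d s) <> 0 /\
    avoids m e (line z d s)).
Proof.
assert (hr := radius_pos_of_ang z hc).
assert (hpi := PI_RGT_0).
assert (H : forall (g : R -> R), ex_derive g 0 -> 0 < g 0 -> locally 0 (fun s => 0 < g s)).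
{ intros g hg h. apply (ex_derive_continuous g) in hg.
  apply hg. apply (open_gt 0). exact h. }
assert (hline := line_0 z d).
apply filter_and; [|apply filter_and].
- apply (H (fun s => bind m (line z d s))).
  + exists (d_bind m (line z d 0) d).
    apply (proj1 (line_derivatives m z d 0 ltac:(now rewrite hline) ltac:(now rewrite hline))).
  + rewrite hline. exact hb.
- apply filter_imp with (fun s => 0 < ang (line z d s) ^ 2).
  { intros s h e0. rewrite e0 in h. lra. }
  apply (H (fun s => ang (line z d s) ^ 2)).
  + unfold ang. cbn [qx qy px py line]. auto_derive. exact I.
  + rewrite hline. now apply pow2_gt_0.
- apply (positive_tube (fun s t => dist2 e (orb_x m (line z d s) t) (orb_y m (line z d s) t))).
  + lra.
  + intros t _. destruct (line_continuity m z d 0 t) as (h1 & h2 & _);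
      [rewrite hline; assumption | rewrite hline; assumption|].
    unfold dist2. cont2. rewrite hline. apply Rplus_le_le_0_compat; apply pow2_ge_0.
  + intros t ht. rewrite hline. now apply hav.
Qed.

Lemma is_derive_avg (e m m2 f : R) (z d : phase) (hb : 0 < bind m z) (hc : ang z <> 0)
  (hav : avoids m e z) :
  is_derive (fun s => avg e m m2 f (line z d s)) 0 (d_avg e m m2 f z d).
Proof.
assert (hr := radius_pos_of_ang z hc). assert (hpi := PI_RGT_0).
assert (hline := line_0 z d).
assert (hnear := line_near e m z d hb hc hav).
assert (hI : is_derive (fun s => RInt (integrand e m m2 f (line z d s)) 0 (2 * PI)) 0
  (RInt (d_integrand e m m2 f z d) 0 (2 * PI))).
{ rewrite (RInt_ext (d_integrand e m m2 f z d)
    (fun t => Derive (fun s => integrand e m m2 f (line z d s) t) 0)).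
  2:{ intros t. rewrite Rmin_left, Rmax_right by lra. intros ht. symmetry.
      rewrite <- hline at 1. apply is_derive_unique.
      apply is_derive_integrand; rewrite hline; trivial. apply hav; lra. }
  apply (is_derive_RInt_param (fun s t => integrand e m m2 f (line z d s) t)).
  - revert hnear. apply filter_imp. intros s (h1 & h2 & h3) t.
    rewrite Rmin_left, Rmax_right by lra. intros ht.
    eexists. apply is_derive_integrand; [now apply radius_pos_of_ang | exact h1 | now apply h3].
  - rewrite Rmin_left, Rmax_right by lra. intros t ht.
    destruct (line_continuity m z d 0 t) as (c1 & c2 & c3 & c4 & c5 & c6);
      [rewrite hline; assumption | rewrite hline; assumption|].
    assert (hd : 0 < dist2 e (orb_x m z t) (orb_y m z t)) by now apply hav.
    assert (cd : continuity_2d_pt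
      (fun s t => dist2 e (orb_x m (line z d s) t) (orb_y m (line z d s) t)) 0 t).
    { unfold dist2. cont2. apply Rplus_le_le_0_compat; apply pow2_ge_0. }
    (* Joint continuity is asked of [Derive]; near (0, t) it coincides with the explicit
       [d_integrand]. *)
    apply (continuity_2d_pt_ext_loc (fun s t => d_integrand e m m2 f (line z d s) d t)).
    + assert (l1 := continuity_2d_pt_pos _ 0 t cd ltac:(cbv beta; rewrite hline; exact hd)).
      assert (l2 : locally_2d (fun s _ => 0 < bind m (line z d s) /\ ang (line z d s) <> 0) 0 t).
      { apply locally_2d_locally. destruct hnear as (delta & hdelta).
        exists delta. intros [s t'] [hs _]. destruct (hdelta s hs) as (? & ? & _). now split. }
      generalize (locally_2d_and _ _ _ _ l1 l2). apply locally_2d_impl, locally_2d_forall.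
      intros s t' [h1 [h2 h3]]. symmetry. apply is_derive_unique, is_derive_integrand;
        [now apply radius_pos_of_ang | exact h2 | exact h1].
    + assert (hd3 : dist2 e (orb_x m (line z d 0) t) (orb_y m (line z d 0) t) ^ 3 <> 0)
        by (rewrite hline; apply pow_nonzero; lra).
      unfold d_integrand, pot, potx, poty. cont2; trivial. rewrite hline; lra.
  - revert hnear. apply filter_imp. intros s (h1 & h2 & h3).
    apply (@ex_RInt_continuous R_CompleteNormedModule). intros t.
    rewrite Rmin_left, Rmax_right by lra. intros ht.
    exact (proj1 (integrand_regular e m m2 f (line z d s) d t (h3 t ht))). }
assert (hbd : is_derive (fun s => bind m (line z d s)) 0 (d_bind m z d)).
{ replace (d_bind m z d) with (d_bind m (line z d 0) d) by (now rewrite hline).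
  apply (proj1 (line_derivatives m z d 0 ltac:(now rewrite hline) ltac:(now rewrite hline))). }
unfold avg.
apply (is_derive_ext (fun s => / (2 * PI * m)
   * (bind m (line z d s) * RInt (integrand e m m2 f (line z d s)) 0 (2 * PI)))).
{ intros s. unfold Rdiv. rewrite <- (Rmult_assoc (/ _)), (Rmult_comm (/ _)). reflexivity. }
der. rewrite hline. unfold d_avg, Rdiv. ring.
Qed.

(** * The Hamiltonian vector field of D *)

(** This is [ang z ^ 2 + 2 * e * lrl_y m z], a combination of conserved quantities of the Kepler
    problem. *)
Definition D_flat (e m : R) (z : phase) : R :=
  ang z ^ 2 - 2 * e * (ang z * px z + m * qy z / radius z).

Definition D_x (e m : R) (z : phase) : R :=
  py z * (2 * ang z - 2 * e * px z) + 2 * e * m * qx z * qy z / radius z ^ 3.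
Definition D_y (e m : R) (z : phase) : R :=
  - (px z * (2 * ang z - 2 * e * px z)) - 2 * e * m * qx z ^ 2 / radius z ^ 3.
Definition D_u (e : R) (z : phase) : R :=
  - (qy z * (ang z - 2 * e * px z)) - (qy z + 2 * e) * ang z.
Definition D_v (e : R) (z : phase) : R := qx z * (2 * ang z - 2 * e * px z).

(** The canonical form (dD/dp, - dD/dq): in these coordinates momenta and velocities coincide. [u]
    and [v] name the momenta. *)
Definition D_field (e m : R) (z : phase) : phase :=
  Phase (D_u e z) (D_v e z) (- D_x e m z) (- D_y e m z).

Lemma is_derive_D_flat (e m : R) (z d : phase) (hr : 0 < radius z) :
  is_derive (fun s => D_flat e m (line z d s)) 0
    (D_x e m z * qx d + D_y e m z * qy d + D_u e z * px d + D_v e z * py d).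
Proof.
assert (hline := line_0 z d).
assert (hx : is_derive (fun s => qx (line z d s)) 0 (qx d))
  by (cbn [qx line]; auto_derive; [exact I | ring]).
assert (hy : is_derive (fun s => qy (line z d s)) 0 (qy d))
  by (cbn [qy line]; auto_derive; [exact I | ring]).
assert (hu : is_derive (fun s => px (line z d s)) 0 (px d))
  by (cbn [px line]; auto_derive; [exact I | ring]).
assert (hv : is_derive (fun s => py (line z d s)) 0 (py d))
  by (cbn [py line]; auto_derive; [exact I | ring]).
assert (hrad : is_derive (fun s => radius (line z d s)) 0 (d_rad z d)).
{ evar_last.
  - apply (is_derive_norm (fun s => qx (line z d s)) (fun s => qy (line z d s)));
      [|eassumption|eassumption].
    change (0 < radius (line z d 0)). now rewrite hline.
  - cbv beta. rewrite hline. reflexivity. }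
unfold D_flat, ang. der; rewrite hline; [lra|].
assert (h2 := radius_sq z).
unfold d_rad, D_x, D_y, D_u, D_v, ang.
apply Rminus_diag_uniq.
(* The quotient rule gives 1/r - y^2/r^3 where [D_y] has x^2/r^3. *)
transitivity (2 * e * m * qy d / radius z ^ 3
  * (qx z ^ 2 + qy z ^ 2 - radius z ^ 2)); [field; lra | rewrite h2; field; lra].
Qed.

(** This is {E_Kep, D} = 0; it also makes [d_freq] and [d_rad_0] vanish along the field. *)
Lemma d_bind_D_field (e m : R) (z : phase) (hr : 0 < radius z) :
  d_bind m z (D_field e m z) = 0.
Proof.
unfold d_bind, d_rad, D_field. cbn [qx qy px py]. unfold D_x, D_y, D_u, D_v, ang.
field. lra.
Qed.

(* The first-order delay, in units of [1 / freq], with which the orbit through [z]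
   displaced along [d] reaches the eccentric anomaly [t]. *)
Definition delay (m : R) (z d : phase) (t : R) : R :=
  d_rad_cos m z d * sin t + d_rad_sin m z d * (1 - cos t).

(* The displacement of the orbit at fixed time is again the Hamiltonian vector field
   of D, because D Poisson commutes with the Kepler energy: the right-hand side is
   [orb_r * dD/dp].  Both sides are trigonometric polynomials of degree 2; the factor of
   cos^2 + sin^2 - 1 in the proof is the coefficient of sin^2 in their difference. *)
Lemma D_field_x (e m : R) (z : phase) (t : R) (hr : 0 < radius z) (hb : 0 < bind m z)
  (d := D_field e m z) :
  harm (d_center_x m z d) (d_cos_x m z d) (d_sin_x m z d) t * orb_r m z t
    - delay m z d t * orb_x' m z t
  = - (2 * (orb_y m z t + e) * orb_r m z t * ang z)
    + 2 * e * orb_y m z t * (freq m z * orb_x' m z t).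
Proof.
assert (h := cos_sin_sq t).
assert (hbd := d_bind_D_field e m z hr). fold d in hbd.
apply Rminus_diag_uniq.
transitivity ((d_sin_x m z d * rad_sin m z + d_rad_cos m z d * cos_x m z
  + 2 * ang z * sin_y m z * rad_sin m z
  + 2 * e * freq m z * sin_y m z * cos_x m z) * (cos t ^ 2 + sin t ^ 2 - 1)).
2:{ rewrite h; ring. }
unfold harm, delay, d_cos_x, d_center_x, d_sin_x, d_rad_cos, d_rad_0, d_rad_sin, d_freq,
  orb_r, orb_x', orb_y, harm.
rewrite hbd. clear hbd h.
unfold d_lrl_x, d_ang, d_rad, d, D_field. cbn [qx qy px py].
unfold D_x, D_y, D_u, D_v.
clear d. rationalize.
generalize (cos t) (sin t) (px z) (py z). intros c' s' u v.
field. auto.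
Qed.

Lemma D_field_y (e m : R) (z : phase) (t : R) (hr : 0 < radius z) (hb : 0 < bind m z)
  (d := D_field e m z) :
  harm (d_center_y m z d) (d_cos_y m z d) (d_sin_y m z d) t * orb_r m z t
    - delay m z d t * orb_y' m z t
  = orb_x m z t * (2 * orb_r m z t * ang z - 2 * e * (freq m z * orb_x' m z t)).
Proof.
assert (h := cos_sin_sq t).
assert (hbd := d_bind_D_field e m z hr). fold d in hbd.
apply Rminus_diag_uniq.
transitivity ((d_sin_y m z d * rad_sin m z + d_rad_cos m z d * cos_y m z
  - 2 * ang z * sin_x m z * rad_sin m z
  - 2 * e * freq m z * sin_x m z * cos_x m z) * (cos t ^ 2 + sin t ^ 2 - 1)).
2:{ rewrite h; ring. }
unfold harm, delay, d_cos_y, d_center_y, d_sin_y, d_rad_cos, d_rad_0, d_rad_sin, d_freq,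
  orb_r, orb_x', orb_y', orb_x, harm.
rewrite hbd. clear hbd h.
unfold d_lrl_y, d_ang, d_rad, d, D_field. cbn [qx qy px py].
unfold D_x, D_y, D_u, D_v.
clear d. rationalize.
generalize (cos t) (sin t) (px z) (py z). intros c' s' u v.
field. auto.
Qed.

(** Conservation of angular momentum, the velocity at anomaly [t] being k q' / r. *)
Lemma orb_ang (m : R) (z : phase) (t : R) (hr : 0 < radius z) (hb : 0 < bind m z) :
  orb_r m z t * ang z
  = freq m z * (orb_x m z t * orb_y' m z t - orb_y m z t * orb_x' m z t).
Proof.
assert (hk := freq_pos m z hb).
assert (h := cos_sin_sq t).
assert (h1 := cos_sin_axes_cross m z hr hb). assert (h2 := cos_axis_cross_center m z hr hb).
assert (h3 := center_cross_sin_axis m z hr hb).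
unfold orb_r, orb_x, orb_y, orb_x', orb_y', harm.
transitivity (freq m z * ((rad_0 m z * ang z / freq m z) * (cos t ^ 2 + sin t ^ 2)
  + (rad_cos m z * ang z / freq m z) * cos t + (rad_sin m z * ang z / freq m z) * sin t)).
- rewrite h. field. lra.
- rewrite <- h1, <- h2, <- h3. ring.
Qed.

(* [corr e m2 f] plays the role of the term which has to be added to D to obtain the first
   integral of the unaveraged problem: (d/dt) corr = {V, D} along Kepler motions. *)
Definition corr (e m2 f x y : R) : R :=
  2 * e * m2 * (y + 2 * e) / dist2 e x y - 2 * f * e ^ 2 * x ^ 2.

(** Along the field of D, r times the displacement of q is delay q' + r dD/dp, and the displacement
    of r is delay'. The delay terms add up to (delay V)'; the rest is r {V, D}, which is k times the
    s-derivative of [corr] because dt = r ds / k. *)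
Definition primitive (e m m2 f : R) (z : phase) (t : R) : R :=
  freq m z * corr e m2 f (orb_x m z t) (orb_y m z t)
  + delay m z (D_field e m z) t * pot e m2 f (orb_x m z t) (orb_y m z t).

Lemma is_derive_primitive (e m m2 f : R) (z : phase) (t : R) (hr : 0 < radius z)
  (hb : 0 < bind m z) (hd : 0 < dist2 e (orb_x m z t) (orb_y m z t)) :
  is_derive (primitive e m m2 f z) t (d_integrand e m m2 f z (D_field e m z) t).
Proof.
assert (hx := is_derive_harm (center_x m z) (cos_x m z) (sin_x m z) t).
assert (hy := is_derive_harm (center_y m z) (cos_y m z) (sin_y m z) t).
change (is_derive (fun t => orb_x m z t) t (orb_x' m z t)) in hx.
change (is_derive (fun t => orb_y m z t) t (orb_y' m z t)) in hy.
assert (hp := is_derive_pot e m2 f (orb_x m z) (orb_y m z) t _ _ hd hx hy).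
assert (hq : is_derive (fun t => dist2 e (orb_x m z t) (orb_y m z t)) t
   ((orb_x m z t * orb_x' m z t + (orb_y m z t + 2 * e) * orb_y' m z t)
    / dist2 e (orb_x m z t) (orb_y m z t))).
{ apply (is_derive_norm (orb_x m z) (fun t => orb_y m z t + 2 * e) t); [exact hd | exact hx|].
  der. apply Rplus_0_r. }
set (d := D_field e m z).
assert (hdel : is_derive (fun t => delay m z d t) t
  (harm (d_rad_0 m z d) (d_rad_cos m z d) (d_rad_sin m z d) t)).
{ unfold delay, harm.
  assert (e0 : d_rad_0 m z d = 0).
  { unfold d_rad_0, d. rewrite d_bind_D_field by exact hr. unfold Rdiv. ring. }
  rewrite e0. auto_derive; [exact I | ring]. }
unfold primitive, corr. fold d. der; [lra|].
unfold d_integrand. fold d.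
assert (kx := D_field_x e m z t hr hb). assert (ky := D_field_y e m z t hr hb).
fold d in kx, ky. cbv zeta in kx, ky.
assert (ha := orb_ang m z t hr hb).
assert (h2 : dist2 e (orb_x m z t) (orb_y m z t) ^ 2
  = orb_x m z t ^ 2 + (orb_y m z t + 2 * e) ^ 2).
{ apply pow2_sqrt. apply Rplus_le_le_0_compat; apply pow2_ge_0. }
revert kx ky ha h2 hd. unfold potx, poty.
generalize (dist2 e (orb_x m z t) (orb_y m z t)) (pot e m2 f (orb_x m z t) (orb_y m z t)).
intros rho V.
generalize (harm (d_center_x m z d) (d_cos_x m z d) (d_sin_x m z d) t)
  (harm (d_center_y m z d) (d_cos_y m z d) (d_sin_y m z d) t)
  (harm (d_rad_0 m z d) (d_rad_cos m z d) (d_rad_sin m z d) t) (delay m z d t)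
  (orb_x m z t) (orb_y m z t) (orb_x' m z t) (orb_y' m z t) (orb_r m z t) (freq m z) (ang z).
intros dX dY dR T X Y X' Y' Rr k C kx ky ha h2 hd.
set (P := m2 * X / rho ^ 3 + 2 * f * X). set (Q := m2 * (Y + 2 * e) / rho ^ 3 + 2 * f * (Y + e)).
transitivity (P * (dX * Rr) + Q * (dY * Rr) + V * dR); [|ring].
replace (dX * Rr) with (T * X' + (- (2 * (Y + e) * (Rr * C)) + 2 * e * Y * (k * X'))) by lra.
replace (dY * Rr) with (T * Y' + X * (2 * (Rr * C) - 2 * e * (k * X'))) by lra.
rewrite ha. unfold P, Q.
apply Rminus_diag_uniq.
(* Only the 1 / rho from differentiating (Y + 2 e) / rho must still be matched with the denominators
   rho^3. *)
transitivity (2 * e * m2 * k * Y' / rho ^ 3 * (rho ^ 2 - (X ^ 2 + (Y + 2 * e) ^ 2))).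
- field. lra.
- rewrite h2. ring.
Qed.

(** * Conclusion *)

Lemma d_avg_D_field (e m m2 f : R) (z : phase) (hb : 0 < bind m z) (hc : ang z <> 0)
  (hav : avoids m e z) : d_avg e m m2 f z (D_field e m z) = 0.
Proof.
assert (hr := radius_pos_of_ang z hc). assert (hpi := PI_RGT_0).
unfold d_avg. rewrite d_bind_D_field by exact hr.
enough (h : RInt (d_integrand e m m2 f z (D_field e m z)) 0 (2 * PI) = 0)
  by (rewrite h; unfold Rdiv; ring).
apply is_RInt_unique. evar_last.
- apply (is_RInt_derive (primitive e m m2 f z)); intros t;
    rewrite Rmin_left, Rmax_right by lra; intros ht.
  + apply is_derive_primitive; [exact hr | exact hb | now apply hav].
  + exact (proj2 (integrand_regular e m m2 f z _ t (hav t ht))).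
- unfold primitive, delay, orb_x, orb_y, harm.
  rewrite cos_2PI, sin_2PI, cos_0, sin_0. apply (@minus_eq_zero R_AbelianGroup).
Qed.

(** The bracket involves the partial derivatives of the average; linearity in the direction
    assembles them into the derivative along [D_field]. *)
Lemma d_avg_line (e m m2 f : R) (z d d' : phase) (c : R) (hb : 0 < bind m z)
  (hc : ang z <> 0) (hav : avoids m e z) :
  d_avg e m m2 f z (line d' d c) = d_avg e m m2 f z d' + c * d_avg e m m2 f z d.
Proof.
assert (hpi := PI_RGT_0).
assert (hI : forall d, ex_RInt (d_integrand e m m2 f z d) 0 (2 * PI)).
{ intros d0. apply (@ex_RInt_continuous R_CompleteNormedModule). intros t.
  rewrite Rmin_left, Rmax_right by lra. intros ht.
  exact (proj2 (integrand_regular e m m2 f z d0 t (hav t ht))). }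
assert (hlin : RInt (d_integrand e m m2 f z (line d' d c)) 0 (2 * PI)
  = RInt (d_integrand e m m2 f z d') 0 (2 * PI) + c * RInt (d_integrand e m m2 f z d) 0 (2 * PI)).
{ transitivity (RInt (fun t => plus (d_integrand e m m2 f z d' t)
    (scal c (d_integrand e m m2 f z d t))) 0 (2 * PI)).
  - apply RInt_ext. intros t _.
    change (d_integrand e m m2 f z (line d' d c) t
      = d_integrand e m m2 f z d' t + c * d_integrand e m m2 f z d t).
    unfold d_integrand, harm, d_cos_x, d_cos_y, d_sin_x, d_sin_y, d_rad_cos, d_rad_sin,
      d_center_x, d_center_y, d_rad_0,
      d_freq, d_lrl_x, d_lrl_y, d_bind, d_ang, d_rad.
    cbn [qx qy px py line]. unfold Rdiv. ring.
  - apply is_RInt_unique.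
    apply (@is_RInt_plus R_NormedModule (d_integrand e m m2 f z d')
      (fun t => scal c (d_integrand e m m2 f z d t))).
    + apply (@RInt_correct R_CompleteNormedModule), hI.
    + apply (@is_RInt_scal R_NormedModule (d_integrand e m m2 f z d)).
      apply (@RInt_correct R_CompleteNormedModule), hI. }
unfold d_avg. rewrite hlin.
unfold d_bind, d_rad. cbn [qx qy px py line]. unfold Rdiv. ring.
Qed.

Lemma d_bind_line (m : R) (z d d' : phase) (c : R) :
  d_bind m z (line d' d c) = d_bind m z d' + c * d_bind m z d.
Proof. unfold d_bind, d_rad. cbn [qx qy px py line]. unfold Rdiv. ring. Qed.

Lemma linear_expansion (L : phase -> R) (x y u v : R)
  (hL : forall d d' c, L (line d' d c) = L d' + c * L d) :
  L (Phase x y u v)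
  = x * L (Phase 1 0 0 0) + y * L (Phase 0 1 0 0) + u * L (Phase 0 0 1 0)
    + v * L (Phase 0 0 0 1).
Proof.
assert (h0 : L (Phase 0 0 0 0) = 0).
{ assert (h := hL (Phase 0 0 0 0) (Phase 0 0 0 0) 1).
  unfold line in h; cbn [qx qy px py] in h. rewrite Rmult_0_r, Rplus_0_r in h. lra. }
transitivity (L (line (line (line (line (Phase 0 0 0 0) (Phase 1 0 0 0) x)
  (Phase 0 1 0 0) y) (Phase 0 0 1 0) u) (Phase 0 0 0 1) v)).
- f_equal. unfold line; cbn [qx qy px py]. f_equal; ring.
- rewrite !hL, h0. ring.
Qed.

(** Each coordinate line of the cotangent space is a flat line up to s -> k (s - t0), and the chain
    rule supplies [k]. The factors for y and its momentum are inverse to each other: the change of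
    coordinates is canonical. *)
Lemma partials_flat (a : R) (F : TR2 -> R) (z : TR2) (L : phase -> R)
  (h : forall d, is_derive (fun s => F (unflat a (line (flat a z) d s))) 0 (L d)) :
  is_derive (fun s => on_cotangent a F s (pos_y z) (legendre_px z) (legendre_py a z))
    (pos_x z) (L (Phase 1 0 0 0)) /\
  is_derive (fun s => on_cotangent a F (pos_x z) s (legendre_px z) (legendre_py a z))
    (pos_y z) (/ sqrt (1 + a ^ 2) * L (Phase 0 1 0 0)) /\
  is_derive (fun s => on_cotangent a F (pos_x z) (pos_y z) s (legendre_py a z))
    (legendre_px z) (L (Phase 0 0 1 0)) /\
  is_derive (fun s => on_cotangent a F (pos_x z) (pos_y z) (legendre_px z) s)
    (legendre_py a z) (sqrt (1 + a ^ 2) * L (Phase 0 0 0 1)).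
Proof.
assert (hs := scale_pos a). assert (hs2 := scale_sq a). assert (hp := one_plus_sq_pos a).
assert (H : forall d k t0, is_derive
  (fun s => F (unflat a (line (flat a z) d (k * (s - t0))))) t0 (k * L d)).
{ intros d k t0.
  apply (is_derive_comp (fun s => F (unflat a (line (flat a z) d s))) (fun s => k * (s - t0))).
  - replace (k * (t0 - t0)) with 0 by ring. apply h.
  - auto_derive; [exact I | ring]. }
revert H. unfold on_cotangent, legendre_px, legendre_py, line, unflat, flat.
cbn [qx qy px py]. unfold xi, eta, xi_dot, eta_dot.
destruct z as [x y u v]. cbn [pos_x pos_y vel_x vel_y].
revert hs hs2. generalize (sqrt (1 + a ^ 2)). intros r hs hs2 H.
split; [|split; [|split]].
- generalize (H (Phase 1 0 0 0) 1 x). rewrite Rmult_1_l. apply is_derive_ext.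
  intros t. cbn [qx qy px py]. f_equal. f_equal; field; lra.
- generalize (H (Phase 0 1 0 0) (/ r) y). apply is_derive_ext.
  intros t. cbn [qx qy px py]. f_equal. f_equal; field; lra.
- generalize (H (Phase 0 0 1 0) 1 u). rewrite Rmult_1_l. apply is_derive_ext.
  intros t. cbn [qx qy px py]. f_equal. f_equal; field; lra.
- generalize (H (Phase 0 0 0 1) r (v / (1 + a ^ 2))). apply is_derive_ext.
  intros t. cbn [qx qy px py]. f_equal. rewrite <- hs2. f_equal; field; lra.
Qed.

Lemma E_Eucl_a_flat (a m m2 f : R) (z : phase) (hm : 0 < m) (hb : 0 < bind m z)
  (hc : ang z <> 0) (hav : avoids m (a / sqrt (1 + a ^ 2)) z) :
  E_Eucl_a a m m2 f (unflat a z)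
  = - / 2 * bind m z + avg (a / sqrt (1 + a ^ 2)) m m2 f z.
Proof.
unfold E_Eucl_a. rewrite average_eq; rewrite ?flat_unflat; trivial.
assert (h := bind_flat a m (unflat a z)). rewrite flat_unflat in h.
unfold avg, integrand. lra.
Qed.

Lemma D_integral_flat (a m : R) (z : TR2) :
  D_integral a m z = D_flat (a / sqrt (1 + a ^ 2)) m (flat a z).
Proof.
unfold D_integral, D_flat, angular_momentum, ang, radius. cbn [qx qy px py flat].
unfold Rdiv. ring.
Qed.

(** Every anomaly [s] is attained by the flow, at time [orb_t] s. *)
Lemma region_avoids (a m : R) (z : TR2) (hm : 0 < m) (hb : 0 < bind m (flat a z))
  (hc : ang (flat a z) <> 0)
  (h : forall t, (pos_x (kepler_flow a m t z), pos_y (kepler_flow a m t z)) <> (0, - a)) :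
  avoids m (a / sqrt (1 + a ^ 2)) (flat a z).
Proof.
intros s _. assert (hs := scale_pos a).
destruct (kepler_flow_orbit a m z hm hb hc) as (th & _ & h2 & _ & h4).
set (Z := flat a z) in *. set (e := a / sqrt (1 + a ^ 2)).
assert (hz := h (orb_t m Z s)).
rewrite <- (unflat_flat a (kepler_flow a m _ z)), h4, h2 in hz.
unfold unflat in hz. cbn [pos_x pos_y qx qy orbit] in hz.
apply sqrt_lt_R0.
destruct (Req_dec (orb_x m Z s) 0) as [e1 | e1].
- apply Rplus_le_lt_0_compat; [apply pow2_ge_0|]. apply pow2_gt_0. intros e2.
  apply hz. f_equal; [exact e1|].
  replace (orb_y m Z s) with (-2 * e) by lra. unfold e. field. lra.
- apply Rplus_lt_le_0_compat; [now apply pow2_gt_0 | apply pow2_ge_0].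
Qed.

Theorem proposition3p1 (a m1 m2 f : R) (ha : 0 < a) (hm1 : 0 < m1) :
  forall z : TR2, region a m1 z ->
    ex_partials a (E_Eucl_a a m1 m2 f) z /\
    ex_partials a (D_integral a m1) z /\
    poisson_bracket a (E_Eucl_a a m1 m2 f) (D_integral a m1) z = 0.
Proof.
intros z (hE & hc & hcol).
assert (hs := scale_pos a).
change (ang (flat a z) <> 0) in hc.
assert (hb : 0 < bind m1 (flat a z)) by (rewrite bind_flat; lra).
assert (hav := region_avoids a m1 z hm1 hb hc hcol).
assert (hr := radius_pos_of_ang _ hc).
set (e := a / sqrt (1 + a ^ 2)) in *. set (Z := flat a z) in *.
set (dE := fun d => - / 2 * d_bind m1 Z d + d_avg e m1 m2 f Z d).
assert (hdE : forall d, is_derive (fun s => E_Eucl_a a m1 m2 f (unflat a (line Z d s))) 0 (dE d)).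
{ intros d.
  (* The closed formula for the averaged energy is available only near [Z], hence the local form of
     extensionality. *)
  apply (is_derive_ext_loc (fun s => - / 2 * bind m1 (line Z d s) + avg e m1 m2 f (line Z d s))).
  - generalize (line_near e m1 Z d hb hc hav). apply filter_imp.
    intros s (k1 & k2 & k3). symmetry. now apply E_Eucl_a_flat.
  - apply (der_add (fun s => - / 2 * bind m1 (line Z d s)) (fun s => avg e m1 m2 f (line Z d s)));
      [|now apply is_derive_avg].
    apply (is_derive_scal (fun s => bind m1 (line Z d s))).
    replace (d_bind m1 Z d) with (d_bind m1 (line Z d 0) d) by (now rewrite line_0).
    apply (proj1 (line_derivatives m1 Z d 0 ltac:(now rewrite line_0) ltac:(now rewrite line_0))). }
assert (hdD : forall d, is_derive (fun s => D_integral a m1 (unflat a (line Z d s))) 0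
  (D_x e m1 Z * qx d + D_y e m1 Z * qy d + D_u e Z * px d + D_v e Z * py d)).
{ intros d. apply (is_derive_ext (fun s => D_flat e m1 (line Z d s))).
  - intros s. rewrite D_integral_flat, flat_unflat. reflexivity.
  - now apply is_derive_D_flat. }
destruct (partials_flat a _ z _ hdE) as (e1 & e2 & e3 & e4).
destruct (partials_flat a _ z
  (fun d => D_x e m1 Z * qx d + D_y e m1 Z * qy d + D_u e Z * px d + D_v e Z * py d) hdD)
  as (d1 & d2 & d3 & d4).
split; [|split].
- repeat apply conj; eexists; eassumption.
- repeat apply conj; eexists; eassumption.
- unfold poisson_bracket, d_x, d_y, d_px, d_py.
  rewrite_derivatives.
  cbn [qx qy px py].
  (* The bracket with D is the derivative along its Hamiltonian vector field. *)
  transitivity (dE (D_field e m1 Z)).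
  + unfold D_field. rewrite (linear_expansion dE (D_u e Z)).
    * field. lra.
    * intros d d' c. unfold dE. rewrite d_bind_line, d_avg_line by assumption. ring.
  + unfold dE. rewrite d_bind_D_field, d_avg_D_field by assumption. ring.
Qed.
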